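(* Let $p$ be a prime, $P$ a nontrivial finite $p$-group, and $\mathcal F$ a saturated fusion system on $P$. Then $\mathcal F$ is generated by $C_{\mathcal F}(\mho^1(Z(P)))$ and $N_{\mathcal F}(J(P))$, i.e. $\mathcal F = \langle C_{\mathcal F}(\mho^1(Z(P))),\, N_{\mathcal F}(J(P))\rangle$.
   Context: $\mho^1(A)$ is the subgroup of $A$ generated by all $p$-th powers of elements of $A$. $J(P)$ is the Thompson subgroup: the subgroup generated by all abelian subgroups of $P$ of maximum order. A category on $P$ has as objects the subgroups of $P$, with $\mathrm{Hom}_{\mathcal F}(Q,R)$ a set of injective group homomorphisms $Q\to R$ such that every morphism is an $\mathcal F$-isomorphism followed by an inclusion. A saturated fusion system on $P$ is such a category containing all homomorphisms induced by conjugation by elements of $P$, in which $\mathrm{Aut}_P(P)$ is a Sylow $p$-subgroup of $\mathrm{Aut}_{\mathcal F}(P)$, and such that for every $\mathcal F$-isomorphism $\varphi: Q\to Q'$ with $Q'$ fully $\mathcal F$-normalized (i.e. $|N_P(Q')|\ge |N_P(Q'')|$ for all $Q''$ $\mathcal F$-isomorphic to $Q'$), $\varphi$ extends to an $\mathcal F$-morphism $N_\varphi\to P$, where $N_\varphi=\{x\in N_P(Q): \exists y\in N_P(\varphi(Q))\ \forall z\in Q,\ \varphi(xzx^{-1})=y\varphi(z)y^{-1}\}$. For $W\le P$: $N_{\mathcal F}(W)$ is the category on $N_P(W)$ whose morphisms $R_1\to R_2$ are those $\mathcal F$-morphisms $\varphi$ admitting an extension $\tilde\varphi: WR_1\to WR_2$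 in $\mathcal F$ with $\tilde\varphi(W)=W$; $C_{\mathcal F}(W)$ is the category on $C_P(W)$ whose morphisms $R_1\to R_2$ are those $\mathcal F$-morphisms admitting an extension $\tilde\varphi: WR_1\to WR_2$ in $\mathcal F$ with $\tilde\varphi|_W=\mathrm{id}_W$. The subsystem generated by a collection of such subcategories is the smallest subcategory of $\mathcal F$ (on $P$) containing all their morphisms and closed under composition and restriction of morphisms to subgroups; the claim is that this equals $\mathcal F$. *)

(* Defs.v *)
From HB Require Import structures.
From mathcomp Require Import all_boot all_fingroup all_solvable.
Set Implicit Arguments. Unset Strict Implicit. Unset Printing Implicit Defensive.

Local Open Scope group_scope.

Section Fusion.
Variable gT : finGroupType.

(* A (potential) morphism Q -> R of a fusion system is recorded as a triple
   (Q, R, f), where f is a function on gT normalized to be 1 outside Q. *)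
Definition htriple := ({set gT} * {set gT} * {ffun gT -> gT})%type.

Definition restrf (Q : {set gT}) (f : gT -> gT) : {ffun gT -> gT} :=
  [ffun x => if x \in Q then f x else 1].

Definition subgrp (P Q : {set gT}) : bool := (Q \subset P) && group_set Q.

Definition inj_hom (Q R : {set gT}) (f : {ffun gT -> gT}) : Prop :=
  [/\ {in Q &, {morph f : x y / x * y}}, {in Q &, injective f},
      f @: Q \subset R & {in ~: Q, forall x, f x = 1}].

Definition category_on (P : {set gT}) (F : {set htriple}) : Prop :=
  [/\ (forall Q R f, (Q, R, f) \in F -> [/\ subgrp P Q, subgrp P R & inj_hom Q R f]),
      (forall Q, subgrp P Q -> (Q, Q, restrf Q id) \in F),
      (forall Q R S f g, (Q, R, f) \in F -> (R, S, g) \in F ->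
          (Q, S, restrf Q (g \o f)) \in F) &
      (forall Q R f, (Q, R, f) \in F ->
         [/\ (Q, f @: Q, f) \in F,
             (exists g, (f @: Q, Q, g) \in F /\ {in Q, cancel f g}) &
             (f @: Q, R, restrf (f @: Q) id) \in F])].

(* F contains Hom_P: conjugation c_g : x |-> g x g^-1 = x ^ g^-1, g in P *)
Definition contains_conj (P : {set gT}) (F : {set htriple}) : Prop :=
  forall Q R g, subgrp P Q -> subgrp P R -> g \in P -> Q :^ g^-1 \subset R ->
    (Q, R, restrf Q (fun x => x ^ g^-1)) \in F.

Definition AutF (P : {set gT}) (F : {set htriple}) : {set {perm gT}} :=
  [set a : {perm gT} | (a \in Aut P) && ((P, P, restrf P a) \in F)].

Definition AutP (P : {set gT}) : {set {perm gT}} :=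
  [set a : {perm gT} | (a \in Aut P) &&
     [exists g in P, [forall x in P, a x == x ^ g^-1]]].

Definition F_iso (F : {set htriple}) (Q R : {set gT}) (f : {ffun gT -> gT}) : Prop :=
  (Q, R, f) \in F /\ f @: Q = R.

Definition fully_normalized (P : {set gT}) (F : {set htriple}) (Q : {set gT}) : Prop :=
  forall Q'' f, F_iso F Q Q'' f -> #|'N_P(Q'')| <= #|'N_P(Q)|.

Definition Nphi (P Q : {set gT}) (f : {ffun gT -> gT}) : {set gT} :=
  [set x in 'N_P(Q) | [exists y in 'N_P(f @: Q),
     [forall z in Q, f (x * z * x^-1) == y * f z * y^-1]]].

Definition saturated (p : nat) (P : {set gT}) (F : {set htriple}) : Prop :=
  [/\ category_on P F, contains_conj P F,
      p.-Sylow(AutF P F) (AutP P) &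
      (forall Q Q' f, F_iso F Q Q' f -> fully_normalized P F Q' ->
         exists psi, (Nphi P Q f, P, psi) \in F /\ {in Q, psi =1 f})].

Definition NF_mor (P : {set gT}) (F : {set htriple}) (W : {set gT})
    (R1 R2 : {set gT}) (f : {ffun gT -> gT}) : Prop :=
  [/\ subgrp 'N_P(W) R1, subgrp 'N_P(W) R2, (R1, R2, f) \in F &
      exists g, [/\ (W * R1, W * R2, g) \in F, g @: W = W & {in R1, g =1 f}]].

Definition CF_mor (P : {set gT}) (F : {set htriple}) (W : {set gT})
    (R1 R2 : {set gT}) (f : {ffun gT -> gT}) : Prop :=
  [/\ subgrp 'C_P(W) R1, subgrp 'C_P(W) R2, (R1, R2, f) \in F &
      exists g, [/\ (W * R1, W * R2, g) \in F, {in W, g =1 id} & {in R1, g =1 f}]].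

Definition sub_closed (P : {set gT}) (G : {set htriple}) : Prop :=
  [/\ (forall Q, subgrp P Q -> (Q, Q, restrf Q id) \in G),
      (forall Q R S f g, (Q, R, f) \in G -> (R, S, g) \in G ->
          (Q, S, restrf Q (g \o f)) \in G) &
      (forall Q R f Q' R', (Q, R, f) \in G -> subgrp Q Q' -> subgrp P R' ->
          f @: Q' \subset R' -> (Q', R', restrf Q' f) \in G)].

Definition fs_generated (P : {set gT}) (F : {set htriple})
    (S : {set gT} -> {set gT} -> {ffun gT -> gT} -> Prop)
    (Q R : {set gT}) (f : {ffun gT -> gT}) : Prop :=
  forall G : {set htriple}, G \subset F ->
    (forall Q1 R1 f1, S Q1 R1 f1 -> (Q1, R1, f1) \in G) ->
    sub_closed P G -> (Q, R, f) \in G.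

Definition mho1 (p : nat) (A : {set gT}) : {set gT} := <<[set x ^+ p | x in A]>>.

Definition max_ab_order (P : {set gT}) : nat :=
  \max_(A : {group gT} | (A \subset P) && abelian A) #|A|.

Definition thompson (P : {set gT}) : {set gT} :=
  <<\bigcup_(A : {group gT} | [&& A \subset P, abelian A & #|A| == max_ab_order P]) A>>.

End Fusion.

(* Main.v *)
Require Import Defs.
From mathcomp Require Import all_boot all_fingroup all_solvable.
Set Implicit Arguments. Unset Strict Implicit. Unset Printing Implicit Defensive.
Local Open Scope group_scope.

(** Let G be a subcategory of F closed under composition and restriction that
contains the two given subsystems. If G <> F, take a morphism outside G whose
domain has maximal order m; the usual argument for Alperin's theorem yields a
fully normalized F-centric subgroup Q of order m with an automorphism outside
G, while every morphism with larger domain is in G.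

Among the pairs (Q, X), where X <= Q is Aut_F(Q)-invariant and contains
Z(N_P(Q)), choose one with (|N_P(X)|, |X|) lexicographically maximal, and put
N = N_P(X). Maximality makes X fully normalized and self-centralizing in P.
Let U be the subgroup generated by the Aut_F(X)-images of Z(N); it lies in
Z(X). Let V = mho^1(U), which contains mho^1(Z(P)). By a Frattini argument,
Aut_F(Q) is the product of the centralizer of V, which is in G, and of
automorphisms that extend to Q C_{N_P(Q)}(V). Hence C_N(V) <= Q, so that
C_N(V) = X by maximality.

An abelian A <= N of maximal order that is normalized by U acts
quadratically on U, so A^p centralizes Omega_1(U); an element of N doing so
centralizes U, and then A centralizes V. With Thompson's replacement this
gives J(N) <= X, and then J(N) = J(Q) is Aut_F(Q)-invariant. Since N_P(J(N))
contains N_P(N), maximality forces N = P, so that Aut_F(Q) lies in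
N_F(J(P)). *)

(** * Abelian subgroups of maximal order *)

Section Thompson.
Variable gT : finGroupType.
Implicit Types (A B D E G H U X : {group gT}).

Canonical thompson_group (E : {set gT}) := Eval hnf in [group of thompson E].
Canonical mho1_group p (E : {set gT}) := Eval hnf in [group of mho1 p E].

Definition max_abelian E : pred {group gT} :=
  fun A => [&& A \subset E, abelian A & #|A| == max_ab_order E].

Lemma leq_max_ab_order E A : A \subset E -> abelian A -> #|A| <= max_ab_order E.
Proof.
move=> sAE cAA; rewrite /max_ab_order.
by rewrite (bigD1 A) ?sAE ?cAA //= leq_maxl.
Qed.

Lemma max_abelian_exists E : {A | max_abelian E A}.
Proof.
have P1 : (1%G \subset E) && abelian (1%G : {group gT}) by rewrite sub1G abelian1.
have [A /andP[sAE cAA] eqA] : {A : {group gT} | (A \subset E) && abelian A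
    & max_ab_order E = #|A|}.
  by apply: eq_bigmax_cond; apply/card_gt0P; exists 1%G.
by exists A; rewrite /max_abelian sAE cAA eqA eqxx.
Qed.

Lemma max_abelian_leq E A B :
  max_abelian E A -> B \subset E -> abelian B -> #|B| <= #|A|.
Proof. by case/and3P=> _ _ /eqP-> sBE cBB; apply: leq_max_ab_order. Qed.

(** The join of [A] and [B] is again abelian, so it cannot have larger order than [A]. *)
Lemma max_abelian_cent E A B :
  max_abelian E A -> B \subset E -> abelian B -> B \subset 'C(A) -> B \subset A.
Proof.
move=> maxA sBE cBB cAB; have /and3P[sAE cAA _] := maxA.
have cABAB : abelian (A <*> B) by rewrite abelianY cAA cBB.
have leAB: #|A <*> B| <= #|A| by apply: max_abelian_leq maxA _ _; rewrite ?join_subG ?sAE.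
have /eqP-> : A :==: A <*> B by rewrite eqEcard joing_subl.
exact: joing_subr.
Qed.

Lemma sub_thompson E A : max_abelian E A -> A \subset thompson E.
Proof. by move=> maxA; rewrite sub_gen // bigcup_sup. Qed.

Lemma thompson_sub_group E H :
  (forall A, max_abelian E A -> A \subset H) -> thompson E \subset H.
Proof. by move=> sH; rewrite gen_subG; apply/bigcupsP=> A; apply: sH. Qed.

Lemma thompson_sub E : thompson E \subset E.
Proof. by apply: thompson_sub_group => A /andP[]. Qed.

Lemma center_sub_thompson E : 'Z(E) \subset thompson E.
Proof.
have [A maxA] := max_abelian_exists E; have /andP[sAE _] := maxA.
apply: subset_trans (sub_thompson maxA).
apply: (max_abelian_cent maxA); rewrite ?center_sub ?center_abelian //.
by rewrite subIset // (centS sAE) orbT.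
Qed.

(** Every abelian subgroup of maximum order in [E] already lies in [D]. So the two maximum orders
    agree, and the same subgroups generate both sides. *)
Lemma thompson_intermediate D E :
  thompson E \subset D -> D \subset E -> thompson D = thompson E.
Proof.
move=> sJD sDE.
have eqm : max_ab_order D = max_ab_order E.
  have [A maxA] := max_abelian_exists E; have [B maxB] := max_abelian_exists D.
  have [/and3P[_ cAA /eqP<-] /and3P[sBD cBB /eqP<-]] := (maxA, maxB).
  have sAD := subset_trans (sub_thompson maxA) sJD.
  apply/eqP; rewrite eqn_leq (max_abelian_leq maxB) //.
  by rewrite (max_abelian_leq maxA) // (subset_trans sBD).
apply/eqP; rewrite eqEsubset; apply/andP; split; apply: thompson_sub_group => A maxA.
  apply: sub_thompson; case/and3P: maxA => sAD cAA mA.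
  by rewrite /max_abelian (subset_trans sAD) // cAA -eqm.
apply: sub_thompson; have [_ cAA mA] := and3P maxA.
by rewrite /max_abelian (subset_trans (sub_thompson maxA)) // cAA eqm.
Qed.

Lemma thompson_char E : thompson E \char E.
Proof.
apply/charP; split=> [|f injf fE]; first exact: thompson_sub.
apply/eqP; rewrite eqEcard card_injm ?thompson_sub // leqnn andbT.
rewrite sub_morphim_pre ?thompson_sub //.
apply: (@thompson_sub_group _ (f @*^-1 thompson_group E)%G) => A /and3P[sAE cAA mA].
rewrite -sub_morphim_pre //; apply: (@sub_thompson E (f @* A)%G).
by rewrite /max_abelian morphim_abelian // card_injm // mA -{2}fE morphimS.
Qed.

(* For u in U \ N(A) with A^u <= N(A), the group H = <A, A^u> equals A (H :&: U),
   and B = (A :&: A^u) (H :&: U) is abelian with |B| = |A|. *)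
Lemma thompson_replacement (p : nat) E A U :
    p.-group E -> max_abelian E A -> U \subset E -> abelian U ->
    A \subset 'N(U) -> ~~ (U \subset 'N(A)) ->
  exists B, [/\ max_abelian E B, A :&: U \proper B :&: U & B \subset 'N(A)].
Proof.
move=> pE maxA sUE cUU nUA nAU; have /and3P[sAE cAA _] := maxA.
(* As [M] is proper in the p-group UA, some w = ua outside [M] normalizes [M]. Since a lies in [M],
   u normalizes [M] too, but not [A], for otherwise u would lie in [M]. Then A^u lies in M^u = M,
   which normalizes [A]. *)
pose M := ('N_U(A) <*> A)%G.
have nAM : M \subset 'N(A) by rewrite join_subG subsetIr normG.
have sMUA : M \proper U <*> A.
  have sMUA : M \subset U <*> A.
    by rewrite join_subG joing_subr subIset ?joing_subl.
  rewrite properE sMUA /=.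
  apply: contra nAU => sUAM; apply: subset_trans nAM.
  by apply: subset_trans sUAM; apply: joing_subl.
have pUA : p.-group (U <*> A) by apply: pgroupS pE; rewrite join_subG sUE.
have /properP[_ [w]] := nilpotent_proper_norm (pgroup_nil pUA) sMUA.
rewrite inE /= norm_joinEr // -/M => /andP[/mulsgP[u a Uu Aa ->] nMw] nMua.
have sNM : 'N_U(A) \subset M := joing_subl _ _.
have sAM : A \subset M := joing_subr _ _.
have nMa : a \in 'N(M) by rewrite (subsetP (normG _)) // (subsetP sAM).
have nMu : u \in 'N(M) by rewrite groupMr in nMw.
have nAu : u \notin 'N(A).
  apply: contra nMua => nAu; apply: (@groupM _ M); last exact: (subsetP sAM).
  by rewrite (subsetP sNM) // inE Uu.
have nAAu : A :^ u \subset 'N(A).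
  by apply: subset_trans nAM; rewrite -(normP nMu) conjSg joing_subr.
pose H := A <*> A :^ u; pose D := A :&: A :^ u.
have defH : H = A * A :^ u by rewrite /H norm_joinEr.
have sHAU : H \subset A * U.
  rewrite /H -norm_joinEl // join_subG joing_subl /=.
  apply/subsetP=> _ /imsetP[x Ax ->].
  have UAx : x \in A <*> U by rewrite (subsetP (joing_subl _ _)).
  by rewrite groupJ // (subsetP (joing_subr _ _)).
have defHU : A * (H :&: U) = H.
  by rewrite setIC group_modl ?joing_subl //; apply/setIidPr.
have fixAU : A :&: U :^ u = A :&: U.
  by rewrite conjGid.
have defDU : D :&: (H :&: U) = A :&: U.
  apply/eqP; rewrite eqEsubset; apply/andP; split.
    by rewrite setIA setSI // subIset // subsetIl.
  apply/subsetP=> x /setIP[Ax Ux]; rewrite !inE Ax Ux andbT /=.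
  rewrite (subsetP (joing_subl _ _)) // andbT mem_conjg.
  by rewrite conjgE invgK mulgA (centsP cUU u Uu x Ux) mulgK.
have cDH : D \subset 'C(H).
  rewrite centsC join_subG (sub_abelian_cent2 cAA) ?subsetIl //.
  by rewrite (sub_abelian_cent2 (_ : abelian (A :^ u))) ?subsetIr ?abelianJ.
pose B := (D <*> (H :&: U))%G.
have cDHU : H :&: U \subset 'C(D) by rewrite centsC (subset_trans cDH) // centS ?subsetIl.
have defB : B :=: D * (H :&: U) by rewrite /= cent_joinEr.
have sHE : H \subset E.
  by rewrite join_subG sAE -(conjGid (subsetP sUE u Uu)) conjSg.
have sBH : B \subset H by rewrite join_subG subsetIl subIset ?joing_subl.
have sBE : B \subset E := subset_trans sBH sHE.
have cBB : abelian B.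
  by rewrite abelianY cDHU (abelianS _ cAA) ?(abelianS _ cUU) ?subsetIl ?subsetIr.
(* Three product formulas are combined: |D||H ∩ U| = |B||A ∩ U|, |A|^2 = |H||D| and |A||H ∩ U| =
   |H||A ∩ U|. *)
have cardB : #|B| = #|A|.
  have eB := mul_cardG D (H :&: U); rewrite -defB defDU in eB.
  have eH := mul_cardG A (A :^ u); rewrite -defH -/D cardJg in eH.
  have eHU := mul_cardG A (H :&: U).
  rewrite defHU setIA (setIidPl (joing_subl _ _)) in eHU.
  apply/eqP; rewrite -(eqn_pmul2r (cardG_gt0 (A :&: U))) -eB.
  rewrite -(eqn_pmul2l (cardG_gt0 H)) mulnA -eH -mulnA eHU.
  by rewrite mulnCA.
exists B; split.
- by rewrite /max_abelian sBE cBB cardB; case/and3P: maxA.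
- have sHUB : H :&: U \subset B :&: U by rewrite subsetI subsetIr joing_subr.
  rewrite properE -{1}defDU subIset ?sHUB ?orbT //=.
  (* If the intersection with [U] did not grow, then H = A(H ∩ U) would equal [A], and u would
     normalize [A]. *)
  apply: contra nAu => sBUA; have sHA : H \subset A.
    by rewrite -defHU mul_subG // (subset_trans (subset_trans sHUB sBUA)) ?subsetIl.
  rewrite inE (subset_trans _ sHA) ?joing_subr //.
by rewrite (subset_trans sBH) // join_subG normG.
Qed.


(** Each [u, a] lies in both [A] and [U], so a commutes with it and u^(a^n) = u [u, a]^n. If u^p =
    1, applying a to u^p gives [u, a]^p = 1, so a^p fixes u. By the last hypothesis a^p then
    centralizes [U], whence [u, a]^p = 1 for every u, which says that a fixes u^p. *)
Lemma quadratic_cent_mho1 (p : nat) A U :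
    abelian A -> abelian U -> A \subset 'N(U) -> U \subset 'N(A) ->
    (forall x, x \in A -> {in U, forall u, u ^+ p = 1 -> u ^ x = u} ->
       x \in 'C(U)) ->
  A \subset 'C(mho1 p U).
Proof.
move=> cAA cUU nUA nAU centU; apply/subsetP=> a Aa.
have com u : u \in U -> [/\ [~ u, a] \in U, [~ u, a] \in A & u ^ a = u * [~ u, a]].
  move=> Uu; have nUa := subsetP nUA a Aa; have nAu := subsetP nAU u Uu.
  split; last by rewrite conjg_mulR.
    by rewrite commgEl groupM ?groupV ?memJ_norm.
  by rewrite commgEr groupM ?memJ_norm ?groupV.
have powE u n : u \in U -> u ^ (a ^+ n) = u * [~ u, a] ^+ n.
  case/com=> _ Aw Ja; elim: n => [|n IHn]; first by rewrite !expg0 conjg1 mulg1.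
  rewrite expgSr conjgM IHn conjMg {1}Ja -mulgA conjXg.
  by rewrite [_ ^ a]conjgE (centsP cAA _ Aw _ Aa) mulKg -expgS.
have pE u : u \in U -> (u ^+ p) ^ a = u ^+ p * [~ u, a] ^+ p.
  move=> Uu; have [Uw _ Ja] := com u Uu.
  by rewrite conjXg Ja expgMn //; apply: (centsP cUU).
have cap : a ^+ p \in 'C(U).
  apply: centU => [|u Uu up1]; first exact: groupX.
  rewrite powE //; have := pE u Uu; rewrite up1 conj1g mul1g => <-.
  exact: mulg1.
rewrite -sub1set centsC gen_subG; apply/subsetP=> _ /imsetP[u Uu ->].
rewrite -sub_cent1 sub1set; apply/cent1P/commute_sym/commgP/conjg_fixP.
have := powE u p Uu; rewrite conjgE -(centP cap u Uu) mulKg -[u in LHS]mulg1.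
by move/mulgI=> w1; rewrite pE // -w1 mulg1.
Qed.

(** Induction on |U| - |A ∩ U|. If [U] normalizes [A], quadratic action puts [A] in the centralizer
    of mho^1(U). Otherwise replacement gives some [B] meeting [U] in more; by induction [B]
    centralizes [U], hence contains it, and [B] normalizes [A]: a contradiction. *)
Lemma thompson_cent (p : nat) E U :
    p.-group E -> U \subset E -> E \subset 'N(U) -> abelian U ->
    (forall x, x \in E -> {in U, forall u, u ^+ p = 1 -> u ^ x = u} ->
       x \in 'C(U)) ->
    'C_E(mho1 p U) \subset 'C(U) ->
  thompson E \subset 'C(U).
Proof.
move=> pE sUE nUE cUU centU cEV; apply: thompson_sub_group => A maxA.
have [n] := ubnP (#|U| - #|A :&: U|); elim: n A maxA => // n IHn A maxA ltn.
have /and3P[sAE cAA _] := maxA; have nUA := subset_trans sAE nUE.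
have [nAU | nAU] := boolP (U \subset 'N(A)).
  apply: subset_trans cEV; rewrite subsetI sAE quadratic_cent_mho1 // => x Ax.
  exact/centU/(subsetP sAE).
have [B [maxB ltAB nAB]] := thompson_replacement pE maxA sUE cUU nUA nAU.
have sUB : U \subset B.
  apply: (max_abelian_cent maxB) => //; rewrite centsC; apply: IHn => //.
  rewrite -ltnS; apply: leq_trans ltn; rewrite ltnS ltn_sub2l ?(proper_card ltAB) //.
  by rewrite (leq_trans (proper_card ltAB)) ?subset_leq_card ?subsetIr.
by rewrite (subset_trans sUB) in nAU.
Qed.

End Thompson.

(** * Groups of automorphisms *)

Section AutomorphismGroups.
Variables (gT : finGroupType) (X : {group gT}) (G : {group {perm gT}}).
Hypothesis autG : G \subset Aut X.
Implicit Types (a b : {perm gT}) (E H U : {group gT}).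

Lemma Aut_gen_closed a (S : {set gT}) H :
    a \in Aut X -> S \subset X -> (forall s, s \in S -> a s \in H) ->
  forall s, s \in <<S>> -> a s \in H.
Proof.
move=> Xa sSX SH s; rewrite -(autmE Xa) => Ss.
suffices: <<S>> \subset autm Xa @*^-1 H by move/subsetP/(_ s Ss)/morphpreP => [].
rewrite gen_subG; apply/subsetP=> t St.
by apply/morphpreP; rewrite (subsetP sSX) //= autmE; split; last exact: SH.
Qed.

Lemma astab_stable_normal (S : {set gT}) :
  {in G & S, forall a s, a s \in S} -> 'C_G(S | 'P) <| G.
Proof.
move=> GS; apply: normalGI (astab_normal _ _).
by apply/subsetP=> a Ga; rewrite !inE; apply/subsetP=> s Ss; rewrite inE; apply: GS.
Qed.

(** This is the subgroup U of the overview when [G] is Aut_F(X) and [E] is N_P(X). *)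
Definition center_closure (E : {set gT}) :=
  <<\bigcup_(a in G) [set a z | z in 'Z(E)]>>.

Canonical center_closure_group E := Eval hnf in [group of center_closure E].

Lemma sub_center_closure (E : {set gT}) : 'Z(E) \subset center_closure E.
Proof.
apply: sub_gen; apply/subsetP=> z Ez; apply/bigcupP; exists 1; rewrite ?group1 //.
by apply/imsetP; exists z; rewrite ?perm1.
Qed.

(** Z(E) centralizes [X], so by the first hypothesis it lies in Z(X), which is characteristic in
    [X]. *)
Lemma center_closure_sub_center E :
  'C_E(X) \subset X -> X \subset E -> center_closure E \subset 'Z(X).
Proof.
move=> cEX sXE; rewrite gen_subG; apply/bigcupsP=> a Ga.
have Xa := subsetP autG a Ga; have sZX : 'Z(E) \subset 'Z(X).
  rewrite subsetI (subset_trans _ cEX) ?setIS ?centS //=.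
  by rewrite subIset // centS ?orbT.
apply/subsetP=> _ /imsetP[z Ez ->]; have /setIP[Xz cXz] := subsetP sZX z Ez.
have /charP[_ /(_ (autm_morphism Xa) (injm_autm Xa) (im_autm Xa)) /= fixZ] := center_char X.
by rewrite -fixZ -(autmE Xa) mem_morphim // inE Xz.
Qed.

Lemma center_closure_stable E :
    center_closure E \subset X ->
  {in G & center_closure E, forall a u, a u \in center_closure E}.
Proof.
move=> sUX a u Ga Uu.
apply: (@Aut_gen_closed a _ (center_closure_group E)) Uu; first exact: subsetP Ga.
  by apply: subset_trans sUX; apply: subset_gen.
move=> _ /bigcupP[b Gb /imsetP[z Ez ->]]; rewrite -permM mem_gen //.
by apply/bigcupP; exists (b * a); rewrite ?groupM //; apply: imset_f.
Qed.

Lemma mho1_stable p U :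
    U \subset X -> {in G & U, forall a u, a u \in U} ->
  {in G & mho1 p U, forall a u, a u \in mho1 p U}.
Proof.
move=> sUX GU a u Ga Vu; have Xa := subsetP autG a Ga.
apply: (@Aut_gen_closed a _ (mho1_group p U)) Vu => //.
  by apply/subsetP=> _ /imsetP[v Uv ->]; rewrite groupX // (subsetP sUX).
move=> _ /imsetP[v Uv ->]; rewrite -(autmE Xa) morphX ?(subsetP sUX) //= autmE.
by rewrite mem_gen //; apply: imset_f; apply: GU.
Qed.

(** The pointwise stabilizer of [S] is normal in [G], and its intersection with [B] is a Sylow
    subgroup of it, so the Frattini argument applies. *)
Lemma Frattini_stable (p : nat) (B : {group {perm gT}}) (S : {set gT}) :
    {in G & S, forall a s, a s \in S} -> p.-Sylow(G) B ->
  forall a, a \in G ->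
    exists k n, [/\ k \in 'C_G(S | 'P), n \in 'N_G('C_B(S | 'P)) & a = k * n].
Proof.
move=> GS sylB a; have nKG := astab_stable_normal GS.
have sylD := Hall_setI_normal nKG sylB.
have eqD : B :&: 'C_G(S | 'P) = 'C_B(S | 'P).
  by rewrite setIA (setIidPl (pHall_sub sylB)).
rewrite -{1}(Frattini_arg nKG sylD) /= eqD => /mulsgP[k n Kk Nn ->].
by exists k, n.
Qed.

(* If k fixes the elements u of U with u ^+ (p ^ i) = 1, then k ^+ p fixes those
   with u ^+ (p ^ i.+1) = 1. *)
Lemma astab_Ohm1_pgroup (p : nat) U :
    prime p -> p.-group U -> abelian U -> U \subset X ->
    {in G & U, forall a u, a u \in U} ->
  p.-group ('C_G([set u in U | u ^+ p == 1] | 'P) / 'C_G(U | 'P)).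
Proof.
move=> p_pr pU cUU sUX GU; rewrite -pnat_exponent.
have [e oU] := p_natP pU.
suffices: exponent ('C_G([set u in U | u ^+ p == 1] | 'P) / 'C_G(U | 'P)) %| p ^ e.
  by move/pnat_dvd; apply; rewrite pnatX pnat_id.
apply/exponentP=> _ /morphimP[k nCk /setIP[Gk /astabP fix1] ->].
rewrite -morphX //; apply/coset_id; rewrite inE groupX //=; apply/astabP=> u Uu.
rewrite /= apermE.
have: u ^+ (p ^ e) = 1 by rewrite -oU expg_cardG.
have{nCk} Xn n : k ^+ n \in Aut X by rewrite groupX ?(subsetP autG).
elim: {oU}e u Uu => [u _|i IHi u Uu upi1].
  by rewrite !expg1 => ->; rewrite -(autmE (Xn 1%N)) morph1.
(* By induction b fixes u^p, so the displacement w = u^-1 b(u) satisfies w^p = 1 and is fixed by k.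
   Hence b^n(u) = u w^n, and n = p gives the claim. *)
pose b := k ^+ (p ^ i); have Gb : b \in G by rewrite groupX.
pose w := u^-1 * b u; have Uw : w \in U by rewrite groupM ?groupV ?GU.
have bE : b =1 autm (Xn (p ^ i)%N) by move=> x; rewrite autmE.
have Ja : b u = u * w by rewrite mulKVg.
have w1 : w ^+ p = 1.
  rewrite expgMn; last by apply: (centsP cUU); rewrite ?groupV ?GU.
  rewrite expgVn bE -morphX ?(subsetP sUX) //= -bE IHi ?groupX ?mulVg //.
  by rewrite -expgM -expnS.
have bw : b w = w.
  have kw : k w = w by have := fix1 w; rewrite /= apermE => -> //; rewrite inE Uw w1 eqxx.
  rewrite /b; elim: (p ^ i)%N => [|n IHn]; first by rewrite perm1.
  by rewrite expgSr permM IHn.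
have powE n : (b ^+ n) u = u * w ^+ n.
  elim: n => [|n IHn]; first by rewrite perm1 mulg1.
  rewrite expgSr permM IHn bE morphM ?morphX ?groupX ?(subsetP sUX) //= -bE Ja.
  by rewrite -bE bw -mulgA -expgS.
by rewrite expnSr expgM powE w1 mulg1.
Qed.


(* K, the stabilizer of Omega_1(U), equals C_G(U) D with D the part of the
   Sylow subgroup in K, so G = C_G(U) N_G(D) by Frattini; as D centralizes
   Z(E), it centralizes all images of Z(E). *)
Lemma center_closure_cent (p : nat) E :
    prime p -> p.-group E -> X <| E -> 'C_E(X) \subset X ->
    p.-Sylow(G) (conj_aut X @* E) ->
  forall x, x \in E ->
    {in center_closure E, forall u, u ^+ p = 1 -> u ^ x = u} ->
  x \in 'C(center_closure E).
Proof.
move=> p_pr pE /andP[sXE nXE] cEX sylB x Ex fix1.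
set U := center_closure_group E; have sUZ := center_closure_sub_center cEX sXE.
have sUX : U \subset X := subset_trans sUZ (center_sub X).
have cUU : abelian U := abelianS sUZ (center_abelian X).
have pU : p.-group U := pgroupS (subset_trans sUX sXE) pE.
have GU := center_closure_stable sUX.
pose S := [set u in U | u ^+ p == 1]; set B := (conj_aut X @* E)%G in sylB.
have GS : {in G & S, forall a u, a u \in S}.
  move=> a u Ga; rewrite !inE => /andP[Uu /eqP up1]; rewrite GU //=.
  have Xa := subsetP autG a Ga.
  by rewrite -(autmE Xa) -morphX ?(subsetP sUX) // up1 morph1.
have nKG := astab_stable_normal GS; have nCG := astab_stable_normal GU.
have sCK : 'C_G(U | 'P) \subset 'C_G(S | 'P).
  by rewrite setIS // astabS //; apply/subsetP=> u; rewrite inE => /andP[].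
pose D := (B :&: 'C_G(S | 'P))%G.
have sylD : p.-Sylow('C_G(S | 'P)) D := Hall_setI_normal nKG sylB.
have sDG : D \subset G by rewrite subIset // (pHall_sub sylB).
have nCGG := normal_norm nCG.
(* The quotient of the two stabilizers is a p-group, so the image of the Sylow subgroup [D] is all
   of it. *)
have defK : 'C_G(U | 'P) * D = 'C_G(S | 'P).
  have sylDq : p.-Sylow('C_G(S | 'P) / 'C_G(U | 'P)) (D / 'C_G(U | 'P)).
    by apply: quotient_pHall => //; apply: subset_trans sDG nCGG.
  have := pHall_id sylDq (astab_Ohm1_pgroup p_pr pU cUU sUX GU).
  move=> eqDK; apply/eqP; rewrite eqEsubset mul_subG ?(pHall_sub sylD) //=.
  rewrite -quotientSK ?eqDK ?subxx //.
  by apply: subset_trans nCGG; apply: subsetIl.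
have nXx := subsetP nXE x Ex.
have Dx : conj_aut X x \in D.
  rewrite !inE mem_morphim //= (subsetP (pHall_sub sylB)) ?mem_morphim //=.
  apply/subsetP=> u; rewrite !inE => /andP[Uu /eqP up1].
  by rewrite apermE norm_conj_autE ?(subsetP sUX) // fix1.
rewrite -sub1set centsC gen_subG; apply/bigcupsP=> a Ga.
have: a \in 'C_G(U | 'P) * D * 'N_G(D) by rewrite defK (Frattini_arg nKG sylD).
case/mulsgP=> [_ n /mulsgP[c d /setIP[Gc /astabP Cc] Dd ->] /setIP[Gn nDn] {a Ga}->].
apply/subsetP=> _ /imsetP[z Ez ->].
have Uz : z \in U := subsetP (sub_center_closure E) z Ez.
rewrite -mulgA permM; have := Cc z Uz; rewrite /= apermE => ->.
have Gdn : d * n \in G by rewrite groupM // (subsetP sDG).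
have nDdn : d * n \in 'N(D) by rewrite groupM // (subsetP (normG D)).
move: {d n Dd Gn nDn} (d * n) Gdn nDdn => n Gn nDn.
have XU u : u \in U -> u \in X by apply: subsetP.
rewrite -sub_cent1 sub1set; apply/cent1P/commute_sym/commgP/conjg_fixP.
rewrite -(@norm_conj_autE _ X) ?XU ?GU //.
(* Conjugating by n^-1 turns the action of x on n(z) into the action on z of an element of [D]. That
   element is induced by some y in [E], which fixes z because z lies in Z(E). *)
have: (conj_aut X x) ^ n^-1 \in D by rewrite memJ_norm ?groupV.
case/setIP=> /morphimP[y nXy Ey def_y] _.
rewrite -permM conjgCV def_y permM norm_conj_autE ?XU //.
by rewrite conjgE (centP (subsetP (subsetIr _ _) z Ez)) ?mulKg.
Qed.

(** Since U lies in Z(X), the last hypothesis makes the centralizer of mho^1(U) in [E] centralize U.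
    So J(E) centralizes U, hence mho^1(U), and the same hypothesis places J(E) in [X]. *)
Lemma thompson_sub_of_mho1_cent (p : nat) E :
    prime p -> p.-group E -> X <| E -> 'C_E(X) \subset X ->
    p.-Sylow(G) (conj_aut X @* E) ->
    'C_E(mho1 p (center_closure E)) \subset X ->
  thompson E \subset X.
Proof.
move=> p_pr pE nXE cEX sylB cEV; have [sXE nXE'] := andP nXE.
set U := center_closure_group E; have sUZ := center_closure_sub_center cEX sXE.
have sUX : U \subset X := subset_trans sUZ (center_sub X).
have sVU : mho1 p U \subset U.
  by rewrite gen_subG; apply/subsetP=> _ /imsetP[u Uu ->]; apply: groupX.
apply: subset_trans (cEV); rewrite subsetI thompson_sub.
apply: subset_trans (centS sVU).
apply: (@thompson_cent _ p E U) => //.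
- exact: subset_trans sXE.
- apply/subsetP=> x Ex; rewrite inE; apply/subsetP=> _ /imsetP[u Uu ->].
  rewrite -(@norm_conj_autE _ X) ?(subsetP nXE') ?(subsetP sUX) //.
  apply: center_closure_stable => //; rewrite (subsetP (pHall_sub sylB)) //.
  by rewrite mem_morphim ?(subsetP nXE').
- exact: abelianS sUZ (center_abelian X).
- exact: center_closure_cent.
by apply: (subset_trans cEV); rewrite centsC (subset_trans sUZ) ?subsetIr.
Qed.

End AutomorphismGroups.

(** * Fusion systems *)

Section Restriction.
Variable gT : finGroupType.
Implicit Types (Q R : {set gT}) (f g : gT -> gT).

Lemma restrf_in Q f x : x \in Q -> restrf Q f x = f x.
Proof. by rewrite ffunE => ->. Qed.

Lemma eq_restrf Q f g : {in Q, f =1 g} -> restrf Q f = restrf Q g.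
Proof. by move=> eqfg; apply/ffunP=> x; rewrite !ffunE; case: ifP => // /eqfg. Qed.

Lemma im_restrf Q R f : R \subset Q -> [set restrf Q f x | x in R] = f @: R.
Proof. by move=> sRQ; apply: eq_in_imset => x Rx; rewrite restrf_in ?(subsetP sRQ). Qed.

Lemma subgrpE (P : {set gT}) (Q : {group gT}) : subgrp P Q = (Q \subset P).
Proof. by rewrite /subgrp groupP andbT. Qed.

End Restriction.

(** * Morphisms into P and automorphism groups of subgroups *)

Section Category.
Variables (gT : finGroupType) (P : {group gT}) (F : {set htriple gT}).
Hypotheses (catF : category_on P F) (conjF : contains_conj P F).
Implicit Types (D Q R S V X Y : {group gT}) (f g : gT -> gT) (a b : {perm gT}).

(** The codomain is fixed to [P] and only the values of [f] on [Q] count, so maps can be composed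
    and compared without normalizing them. [mor_triple] recovers the other codomains. *)
Definition mor (Q : {set gT}) f := (Q, P : {set gT}, restrf Q f) \in F.

Lemma eq_mor Q f g : {in Q, f =1 g} -> mor Q f = mor Q g.
Proof. by rewrite /mor => /eq_restrf->. Qed.

Lemma triple_restrf (Q R : {set gT}) (f : {ffun gT -> gT}) :
  (Q, R, f) \in F -> restrf Q f = f.
Proof.
case: catF => homF _ _ _ /homF[_ _ [_ _ _ f1]]; apply/ffunP=> x; rewrite ffunE.
by case: ifPn => // nQx; rewrite f1 // inE.
Qed.

Lemma triple_groups (Q R : {set gT}) (f : {ffun gT -> gT}) :
  (Q, R, f) \in F -> [/\ subgrp P Q, subgrp P R & f @: Q \subset R].
Proof. by case: catF => homF _ _ _ /homF[? ? [_ _ ? _]]. Qed.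

Lemma mor_sub Q f : mor Q f -> Q \subset P.
Proof. by case/triple_groups; rewrite subgrpE. Qed.

Lemma mor_im Q f : mor Q f -> f @: Q \subset P.
Proof. by case/triple_groups=> _ _; rewrite im_restrf. Qed.

Lemma mor_mem Q f x : mor Q f -> x \in Q -> f x \in P.
Proof. by move/mor_im/subsetP=> sfQP Qx; rewrite sfQP ?imset_f. Qed.

Lemma morM Q f : mor Q f -> {in Q &, {morph f : x y / x * y}}.
Proof.
case: catF => homF _ _ _ /homF[_ _ [fM _ _ _]] x y Qx Qy.
by have := fM x y Qx Qy; rewrite !restrf_in ?groupM.
Qed.

Lemma mor_inj Q f : mor Q f -> {in Q &, injective f}.
Proof.
case: catF => homF _ _ _ /homF[_ _ [_ fI _ _]] x y Qx Qy eqf.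
by apply: fI => //; rewrite !restrf_in.
Qed.

Lemma mor_injm Q f (mf : mor Q f) : 'injm (Morphism (morM mf)).
Proof. by apply/injmP=> x y Qx Qy; apply: mor_inj mf _ _ Qx Qy. Qed.

Lemma mor_imE Q R f (mf : mor Q f) : R \subset Q -> f @: R = Morphism (morM mf) @* R.
Proof. by move=> sRQ; rewrite morphimEsub. Qed.

Lemma mor_im_group Q R f : mor Q f -> R \subset Q ->
  exists2 S : {group gT}, f @: R = S & #|S| = #|R|.
Proof.
move=> mf sRQ; exists (Morphism (morM mf) @* R)%G; first exact: mor_imE.
by rewrite card_injm ?mor_injm.
Qed.

Lemma mor_conj Q x : Q \subset P -> x \in P -> mor Q (conjg^~ x).
Proof.
move=> sQP Px; have := conjF (g := x^-1) (Q := Q) (R := P).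
rewrite !subgrpE invgK; apply=> //; first by rewrite groupV.
by rewrite -(conjGid Px) conjSg.
Qed.

Lemma mor_id Q : Q \subset P -> mor Q id.
Proof.
move=> sQP; have := mor_conj sQP (group1 P).
by rewrite (@eq_mor _ _ id) // => x _; rewrite conjg1.
Qed.

Lemma incl_triple Q R :
  Q \subset R -> R \subset P -> (Q : {set gT}, R : {set gT}, restrf Q id) \in F.
Proof.
move=> sQR sRP; have := conjF (g := 1) (Q := Q) (R := R).
rewrite !subgrpE invg1 conjsg1 (@eq_restrf _ _ _ id); last by move=> x _; rewrite conjg1.
by apply=> //; rewrite (subset_trans sQR).
Qed.

Lemma triple_mor (Q R : {set gT}) (f : {ffun gT -> gT}) : (Q, R, f) \in F -> mor Q f.
Proof.
move=> Ff; have [_ /andP[sRP gR] sfR] := triple_groups Ff.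
have FRP := @incl_triple (Group gR) P sRP (subxx P).
case: catF => _ _ compF _; have := compF _ _ _ _ _ Ff FRP.
congr (_ \in F); congr (_, _, _); apply: eq_restrf => x Qx.
by rewrite /= restrf_in // (subsetP sfR) ?imset_f.
Qed.

Lemma mor_triple Q R f :
  mor Q f -> f @: Q \subset R -> R \subset P -> (Q : {set gT}, R : {set gT}, restrf Q f) \in F.
Proof.
move=> mf sfR sRP; have [S eqS _] := mor_im_group mf (subxx Q).
case: catF => _ _ compF /(_ _ _ _ mf)[]; rewrite im_restrf // eqS => FQS _ _.
have FSR : (S : {set gT}, R : {set gT}, restrf S id) \in F.
  by apply: incl_triple; rewrite -?eqS.
have := compF _ _ _ _ _ FQS FSR; congr (_ \in F); congr (_, _, _).
apply: eq_restrf => x Qx; rewrite /= restrf_in restrf_in // -eqS.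
exact: imset_f.
Qed.

Lemma mor_comp Q R f g : mor Q f -> mor R g -> f @: Q \subset R -> mor Q (g \o f).
Proof.
move=> mf mg sfR; have FQR := mor_triple mf sfR (mor_sub mg).
case: catF => _ _ compF _; have := compF _ _ _ _ _ FQR mg.
congr (_ \in F); congr (_, _, _); apply: eq_restrf => x Qx /=.
by rewrite restrf_in restrf_in // (subsetP sfR) ?imset_f.
Qed.

Lemma morS Q R f : mor Q f -> R \subset Q -> mor R f.
Proof.
move=> mf sRQ; have mR := mor_id (subset_trans sRQ (mor_sub mf)).
by apply: (mor_comp mR mf); rewrite imset_id.
Qed.

Lemma mor_inv Q R f : mor Q f -> f @: Q = R ->
  exists g, [/\ mor R g, g @: R = Q, {in Q, cancel f g} & {in R, cancel g f}].
Proof.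
move=> mf eqR; case: (catF) => _ _ _ /(_ _ _ _ mf)[_ [g [Fg gK]] _].
rewrite im_restrf // eqR in Fg.
have fK : {in Q, cancel f g} by move=> x Qx; have := gK x Qx; rewrite restrf_in.
exists g; split=> //; first exact: triple_mor Fg.
  by rewrite -eqR -imset_comp (@eq_in_imset _ _ _ id) ?imset_id.
by move=> y; rewrite -eqR => /imsetP[x Qx ->]; rewrite fK.
Qed.

(** Taking the generated subgroup provides a group structure for every [Q]; when [Q] is a subgroup
    of [P] it adds no elements, by [mem_autF]. *)
Definition autF (Q : {set gT}) := <<[set a in Aut Q | (Q, P : {set gT}, restrf Q a) \in F]>>.

Canonical autF_group Q := Eval hnf in [group of autF Q].

Lemma mem_autF Q a : Q \subset P ->
  (a \in autF Q) = (a \in Aut Q) && ((Q : {set gT}, P : {set gT}, restrf Q a) \in F).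
Proof.
move=> sQP; rewrite /autF gen_set_id; first by rewrite inE.
apply/group_setP; split=> [|{}a b].
  apply/setIdP; split; first exact: group1.
  rewrite -[_ \in F]/(mor Q _) (@eq_mor _ _ id) ?mor_id // => x _.
  by rewrite perm1.
move=> /setIdP[Qa ma] /setIdP[Qb mb]; apply/setIdP; split; first exact: groupM.
rewrite -[_ \in F]/(mor Q _) (@eq_mor _ _ (b \o a)) => [|x _]; last by rewrite permM.
apply: mor_comp ma mb _; apply/subsetP=> _ /imsetP[x Qx ->].
exact: Aut_closed.
Qed.

Lemma autF_Aut Q a : Q \subset P -> a \in autF Q -> a \in Aut Q.
Proof. by move=> sQP; rewrite mem_autF // => /andP[]. Qed.

Lemma autF_sub Q : Q \subset P -> autF Q \subset Aut Q.
Proof. by move=> sQP; apply/subsetP=> a; apply: autF_Aut. Qed.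

Lemma autF_mor Q a : Q \subset P -> a \in autF Q -> mor Q a.
Proof. by move=> sQP; rewrite mem_autF // => /andP[]. Qed.

Lemma autF_closed Q a x : Q \subset P -> a \in autF Q -> x \in Q -> a x \in Q.
Proof. by move=> sQP Qa; apply/Aut_closed/autF_Aut. Qed.

Lemma autF_im Q a : Q \subset P -> a \in autF Q -> a @: Q = Q.
Proof.
move=> sQP Qa; apply: im_perm_on.
by have := autF_Aut sQP Qa; rewrite inE => /andP[].
Qed.

Lemma mor_autF Q f : mor Q f -> f @: Q \subset Q -> exists2 a, a \in autF Q & {in Q, a =1 f}.
Proof.
move=> mf sfQ; have sQP := mor_sub mf.
have fQ : Morphism (morM mf) @* Q = Q.
  by apply/eqP; rewrite eqEcard -(mor_imE mf) // sfQ (mor_imE mf) // card_injm ?mor_injm /=.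
exists (aut (mor_injm mf) fQ); last exact: autE.
rewrite mem_autF // Aut_aut -[_ \in F]/(mor Q _).
by rewrite (@eq_mor _ _ f) //; apply: autE.
Qed.

Definition autP (Q : {group gT}) := conj_aut Q @* 'N_P(Q).

Canonical autP_group Q := Eval hnf in [group of autP Q].

Lemma conj_autF Q x : Q \subset P -> x \in 'N_P(Q) -> conj_aut Q x \in autF Q.
Proof.
move=> sQP /setIP[Px nQx]; rewrite mem_autF // -[_ \in F]/(mor Q _).
rewrite (@eq_mor _ _ (conjg^~ x)) => [|y Qy]; last exact: norm_conj_autE.
rewrite (mor_conj sQP Px) andbT.
by rewrite (subsetP (Aut_conj_aut Q 'N(Q))) // mem_morphim.
Qed.

Lemma autP_sub Q : Q \subset P -> autP Q \subset autF Q.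
Proof. by move=> sQP; apply/subsetP=> _ /morphimP[x _ NPx ->]; apply: conj_autF. Qed.

Lemma autPP Q a : a \in Aut Q ->
  reflect (exists2 x, x \in 'N_P(Q) & {in Q, forall z, a z = z ^ x}) (a \in autP Q).
Proof.
move=> Qa; apply: (iffP idP) => [/morphimP[x nQx NPx ->] | [x NPx eqa]].
  by exists x => // z Qz; rewrite norm_conj_autE.
have nQx : x \in 'N(Q) by case/setIP: NPx.
have -> : a = conj_aut Q x; last by rewrite mem_morphim.
apply: (eq_Aut Qa); first by rewrite (subsetP (Aut_conj_aut Q 'N(Q))) // mem_morphim.
by move=> z Qz; rewrite norm_conj_autE ?eqa.
Qed.

(** * Full normalization and extension of morphisms *)

Hypothesis extF : forall (Q Q' : {set gT}) (f : {ffun gT -> gT}),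
  F_iso F Q Q' f -> fully_normalized P F Q' ->
  exists psi, (Nphi P Q f, P : {set gT}, psi) \in F /\ {in Q, psi =1 f}.

Lemma mor_ext Q D f :
    mor Q f -> fully_normalized P F (f @: Q) -> Q \subset D -> D \subset 'N_P(Q) ->
    {in D, forall x, exists2 y, y \in 'N_P(f @: Q) & {in Q, forall z, f (z ^ x) = f z ^ y}} ->
  exists2 g, mor D g & {in Q, g =1 f}.
Proof.
move=> mf fnQ' sQD sDN Dext; have [S eqS _] := mor_im_group mf (subxx Q).
have isoF : F_iso F Q (f @: Q) (restrf Q f).
  by split; rewrite ?im_restrf // eqS; apply: mor_triple => //; rewrite -?eqS ?mor_im.
have [psi [Fpsi eqpsi]] := extF isoF fnQ'.
have [/andP[_ gN] _ _] := triple_groups Fpsi.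
exists psi => [|x Qx]; last by rewrite eqpsi ?restrf_in.
apply: (@morS (Group gN)); first exact: triple_mor Fpsi.
apply/subsetP=> x Dx; have NDx := subsetP sDN x Dx; rewrite inE NDx im_restrf //.
(* [Nphi] conjugates as x z x^-1 whereas z ^ x is x^-1 z x, hence the inverses. *)
have [y Ny fy] := Dext x^-1 (groupVr Dx).
apply/existsP; exists y^-1; rewrite groupV Ny /=; apply/forall_inP=> z Qz.
have NQx : x^-1 \in 'N(Q) by have /setIP[] := groupVr NDx.
have := fy z Qz; rewrite !conjgE !invgK mulgA => eqf.
rewrite !restrf_in ?eqf ?mulgA //.
by have := memJ_norm z NQx; rewrite conjgE invgK mulgA Qz.
Qed.

Lemma exists_fully_normalized Q : Q \subset P ->
  exists2 f, mor Q f & fully_normalized P F (f @: Q).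
Proof.
move=> sQP; pose good := fun f : {ffun gT -> gT} => (Q : {set gT}, P : {set gT}, f) \in F.
have good0 : good (restrf Q id) by apply: mor_id.
case: (@arg_maxnP _ _ good (fun f : {ffun gT -> gT} => #|'N_P(f @: Q)|) good0) => f goodf maxf.
have mf : mor Q f by apply: triple_mor goodf.
exists f => // R g [Fg eqR]; have [S eqS _] := mor_im_group mf (subxx Q).
rewrite eqS in Fg eqR *; have mg := triple_mor Fg.
have := maxf (restrf Q (g \o f)); rewrite im_restrf // imset_comp eqS eqR.
by apply; apply: mor_comp mf mg _; rewrite eqS.
Qed.

Lemma fully_normalized_leq Q f :
  fully_normalized P F Q -> mor Q f -> #|'N_P(f @: Q)| <= #|'N_P(Q)|.
Proof.
move=> fnQ mf; have [S eqS _] := mor_im_group mf (subxx Q).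
apply: (fnQ _ (restrf Q f)); split; last exact: im_restrf.
by rewrite eqS; apply: mor_triple => //; rewrite -eqS ?mor_im.
Qed.

Lemma mor_norm Q D f :
  mor D f -> Q \subset D -> D \subset 'N(Q) -> f @: D \subset 'N_P(f @: Q).
Proof.
move=> mf sQD nQD; apply/subsetP=> _ /imsetP[x Dx ->].
rewrite inE (mor_mem mf) // inE; apply/subsetP=> _ /imsetP[_ /imsetP[z Qz ->] ->].
have [Dz Qzx] : z \in D /\ z ^ x \in Q by rewrite (subsetP sQD) ?memJ_norm ?(subsetP nQD).
have -> : f z ^ f x = f (z ^ x); last exact: imset_f.
by have := morphJ (Morphism (morM mf)) Dz Dx => /= <-.
Qed.

(** Here [h] is conjugation by [f]. Having it as a group morphism on [Aut Q] lets it carry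
    p-elements and p-subgroups along. *)
Lemma autF_transport Q R f : mor Q f -> f @: Q = R ->
  exists2 h : {morphism Aut Q >-> {perm gT}}, 'injm h &
    {in autF Q, forall a, h a \in autF R /\ {in Q, forall x, h a (f x) = f (a x)}}.
Proof.
move=> mf eqR; have [sQP injf] := (mor_sub mf, mor_injm mf).
have sRP : R \subset P by rewrite -eqR mor_im.
have defR : Morphism (morM mf) @* Q = R by rewrite -mor_imE.
exists (Aut_isom_morphism injf (subxx Q)); first exact: injm_Aut_isom.
move=> a Fa; have Qa := autF_Aut sQP Fa.
have hE : {in Q, forall x, Aut_isom injf (subxx Q) a (f x) = f (a x)} by apply: Aut_isomE.
split=> //; rewrite mem_autF // -{1}defR Aut_Aut_isom -[_ \in F]/(mor R _).
have [g [mg gR fK gK]] := mor_inv mf eqR.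
rewrite (@eq_mor _ _ (f \o (a \o g))) => [|y Ry].
  have mag : mor R (a \o g) by apply: (mor_comp mg (autF_mor sQP Fa)); rewrite gR.
  by apply: (mor_comp mag mf); rewrite imset_comp gR autF_im.
by rewrite /= -hE ?gK // -gR imset_f.
Qed.

(** * Sylow automizers and extension to normalizers *)

Variable p : nat.
Hypotheses (p_pr : prime p) (pP : p.-group P) (sylP : p.-Sylow(autF P) (autP P)).

Lemma autP_pgroup Q : p.-group (autP Q).
Proof. by apply/morphim_pgroup/(pgroupS _ pP)/subsetIl. Qed.

(* A p-automorphism of Q normalizing, but not in, autP Q extends to N = N_P(Q).
   By induction on |P : Q| the extension is conjugate, in a fully normalized
   copy of N, to conjugation by some x; as Q is fully normalized, x lies in
   that copy. *)
Lemma sylow_autP Q : Q \subset P -> fully_normalized P F Q -> p.-Sylow(autF Q) (autP Q).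
Proof.
have [n] := ubnP (#|P| - #|Q|); elim: n Q => // n IHn Q ltn sQP fnQ.
have [eqQP | ltQP] := eqVproper sQP.
  by have -> : Q = P by apply: val_inj.
have [R sylR sBR] := Sylow_superset (autP_sub sQP) (autP_pgroup Q).
have [eqBR | ltBR] := eqVproper sBR; first by rewrite eqBR.
have [sRG pR _] := and3P sylR.
have /properP[_ [a /setIP[Ra nBa] nBa']] := nilpotent_proper_norm (pgroup_nil pR) ltBR.
have Ga := subsetP sRG a Ra; have Qa := autF_Aut sQP Ga.
have ma := autF_mor sQP Ga; have imQ := autF_im sQP Ga.
pose N := 'N_P(Q)%G; have sQN : Q \subset N by rewrite subsetI sQP normG.
(* Since a normalizes [autP Q], it turns conjugation by any x in N_P(Q) into conjugation by some y
   in N_P(Q), so a extends to all of [N]. *)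
have [|x Nx|g mg eqg] := @mor_ext Q N a ma _ sQN (subxx _); rewrite ?imQ //.
  have Fx : conj_aut Q x \in autF Q by apply: conj_autF.
  have Fxa : conj_aut Q x ^ a \in autF Q by rewrite groupJ.
  have /(autPP (autF_Aut sQP Fxa))[y NPy eqy] : conj_aut Q x ^ a \in autP Q.
    by rewrite memJ_norm // mem_morphim //; case/setIP: Nx.
  exists y => // z Qz; rewrite -eqy ?(autF_closed sQP) // -permM -conjgC permM.
  by rewrite norm_conj_autE //; case/setIP: Nx.
have [|b Fb eqb] := mor_autF mg.
  have eqgQ : g @: Q = Q by rewrite -{2}imQ; apply: eq_in_imset.
  by have := mor_norm mg sQN (subsetIr _ _); rewrite eqgQ.
have sNP : N \subset P := subsetIl _ _.
have Qb z : z \in Q -> b z = a z by move=> Qz; rewrite eqb ?(subsetP sQN) ?eqg.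
have actQb : b \in 'N(Q | 'P).
  rewrite !inE; apply/subsetP=> z Qz; rewrite inE /= apermE Qb //.
  exact: autF_closed Ga _.
have resb : restr_perm Q b = a.
  apply/permP=> z; have [Qz | nQz] := boolP (z \in Q).
    by rewrite restr_permE ?Qb.
  by rewrite (out_perm (restr_perm_on _ _)) // (out_Aut Qa).
pose c := b.`_p; have Fc : c \in autF N by rewrite groupX.
have Qc z : z \in Q -> c z = a z.
  move=> Qz; have <- : restr_perm Q c = a; last by rewrite restr_permE ?groupX.
  by rewrite /c morph_constt //= resb constt_p_elt // (mem_p_elt pR).
have [t mt fnt] := exists_fully_normalized sNP.
have [N' eqN' cardN'] := mor_im_group mt (subxx N).
have [h injh hE] := autF_transport mt eqN'.
have sN'P : N' \subset P by rewrite -eqN' mor_im.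
rewrite eqN' in fnt; have [Fhc htc] := hE c Fc.
have ltQN : #|Q| < #|N|.
  exact/proper_card/(nilpotent_proper_norm (pgroup_nil pP)).
have sylN' : p.-Sylow(autF N') (autP N').
  apply: IHn => //; rewrite -ltnS cardN'; apply: leq_trans ltn; rewrite ltnS.
  by rewrite ltn_sub2l // (leq_trans ltQN) // subset_leq_card.
have phc : p.-group <[h c]>.
  by rewrite -[_.-group _]/(p.-elt _) morph_p_elt ?p_elt_constt ?(autF_Aut sNP).
have [|d Fd] := Sylow_Jsub sylN' _ phc; first by rewrite cycle_subG.
rewrite -cycleJ cycle_subG => Phcd.
have Fhcd : h c ^ d \in autF N' by rewrite groupJ.
have [x Nx hx] := autPP (autF_Aut sN'P Fhcd) Phcd.
pose u := d \o t; have mu : mor N u.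
  by apply: (mor_comp mt (autF_mor sN'P Fd)); rewrite eqN'.
have uN : u @: N = N' by rewrite imset_comp eqN' autF_im.
have uc z : z \in N -> u (c z) = u z ^ x.
  move=> Nz; have N'tz : t z \in N' by rewrite -eqN' imset_f.
  by rewrite -hx ?(autF_closed sN'P) // -permM -conjgC permM htc.
(* The image of [N] under u normalizes u(Q), and by full normalization of [Q] its order is already
   the largest possible, so it is N_P(u(Q)). As c preserves [Q], x normalizes u(Q). *)
have N'x : x \in N'.
  have sN'N : N' \subset 'N_P(u @: Q).
    by rewrite -uN; apply: mor_norm mu sQN (subsetIr _ _).
  have eqN : N' :=: 'N_P(u @: Q).
    apply/eqP; rewrite eqEcard sN'N cardN' fully_normalized_leq //.
    exact: morS mu sQN.
  rewrite eqN inE; case/setIP: Nx => -> _; rewrite inE /=.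
  apply/subsetP=> _ /imsetP[_ /imsetP[z Qz ->] ->].
  by rewrite -uc ?(subsetP sQN) // imset_f // Qc // (autF_closed sQP).
have [w Nw def_x] : exists2 w, w \in N & x = u w by apply/imsetP; rewrite uN.
case/negP: nBa'; apply/(autPP Qa); exists w => // z Qz; rewrite -Qc //.
have Nz := subsetP sQN z Qz; apply: (mor_inj mu); rewrite ?groupJ ?(autF_closed sNP) //.
by rewrite uc // def_x; have := morphJ (Morphism (morM mu)) Nz Nw => /= ->.
Qed.


(** [f] carries [autP R] to a p-subgroup of [autF Q], which some d in [autF Q] conjugates into the
    Sylow subgroup [autP Q]. Then d after [f] extends to N_P(R); the extension agrees with [f] on
    [R] only up to d. *)
Lemma mor_extend_normalizer Q R f :
    mor R f -> f @: R = Q -> fully_normalized P F Q ->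
  exists2 g, mor 'N_P(R) g & g @: R = Q.
Proof.
move=> mf fR fnQ; have sRP := mor_sub mf.
have sQP : Q \subset P by rewrite -fR mor_im.
have [h injh hE] := autF_transport mf fR.
have sRN : R \subset 'N_P(R) by rewrite subsetI sRP normG.
have shB : h @* autP R \subset autF Q.
  by apply/subsetP=> _ /morphimP[a _ /(subsetP (autP_sub sRP)) Fa ->]; case: (hE a Fa).
have [d Fd shBd] := Sylow_Jsub (sylow_autP sQP fnQ) shB (morphim_pgroup h (autP_pgroup R)).
have mdf : mor R (d \o f) by apply: (mor_comp mf (autF_mor sQP Fd)); rewrite fR.
have imdf : (d \o f) @: R = Q by rewrite imset_comp fR autF_im.
have [|x NPx|g mg eqg] := @mor_ext R 'N_P(R)%G _ mdf _ sRN (subxx _); rewrite ?imdf //.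
  have Fx := conj_autF sRP NPx; have [Fhx hx] := hE _ Fx.
  have Fhxd : h (conj_aut R x) ^ d \in autF Q by rewrite groupJ.
  have NRx : x \in 'N(R) by case/setIP: NPx.
  have /(autPP (autF_Aut sQP Fhxd))[y Ny eqy] : h (conj_aut R x) ^ d \in autP Q.
    by rewrite (subsetP shBd) // memJ_conjg mem_morphim ?(autF_Aut sRP) // mem_morphim.
  exists y => // z Rz; have Qfz : f z \in Q by rewrite -fR imset_f.
  by rewrite /= -eqy ?(autF_closed sQP) // -permM -conjgC permM hx ?norm_conj_autE.
by exists g => //; rewrite -imdf; apply: eq_in_imset.
Qed.

Lemma fully_normalized_max Q R f :
    mor Q f -> f @: Q = R -> fully_normalized P F R -> #|'N_P(R)| <= #|'N_P(Q)| ->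
  fully_normalized P F Q.
Proof.
move=> mf fQ fnR leRQ S g [Fg <-]; apply: leq_trans leRQ.
have mg := triple_mor Fg; have [f' [mf' f'R fK f'K]] := mor_inv mf fQ.
rewrite -f'R -imset_comp; apply: fully_normalized_leq => //.
by apply: (mor_comp mf' mg); rewrite f'R.
Qed.

(** For the restriction of a to [X], conjugation by q in [Q] corresponds to conjugation by a(q), and
    conjugation by an element of C_P(X) to the identity. So the extension axiom reaches all of Q
    C_P(X). *)
Lemma mor_ext_cent Q X a :
    Q \subset 'N_P(X) -> X \subset Q -> fully_normalized P F X ->
    a \in autF Q -> {in X, forall x, a x \in X} ->
  exists2 g, mor (Q <*> 'C_P(X)) g & {in X, g =1 a}.
Proof.
move=> sQN sXQ fnX Fa aX; have sQP : Q \subset P by apply: subset_trans sQN (subsetIl _ _).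
have ma := autF_mor sQP Fa; have maX := morS ma sXQ.
have imX : a @: X = X.
  apply/eqP; rewrite eqEcard card_imset ?leqnn ?andbT; last exact: perm_inj.
  by apply/subsetP=> _ /imsetP[x Xx ->]; apply: aX.
have sCN : 'C_P(X) \subset 'N_P(X) by rewrite setIS ?cent_sub.
apply: (@mor_ext X (Q <*> 'C_P(X))%G) => //; rewrite ?imX //.
- by apply: subset_trans sXQ (joing_subl _ _).
- by rewrite join_subG sQN.
have nCQ : Q \subset 'N('C_P(X)).
  by apply: subset_trans sQN _; rewrite normsI ?norms_cent ?subsetIr // subIset // normG.
move=> x; rewrite /= norm_joinEl // => /mulsgP[q c Qq /setIP[_ cXc] ->].
have Nq : q \in 'N(X) by case/setIP: (subsetP sQN q Qq).
exists (a q) => [|z Xz]; first by rewrite (subsetP sQN) // (autF_closed sQP).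
have Xzq : z ^ q \in X by rewrite memJ_norm.
rewrite conjgM [_ ^ c]conjgE -(centP cXc _ Xzq) mulKg.
by have := morphJ (Morphism (morM ma)) (subsetP sXQ z Xz) Qq.
Qed.

(** * A subcategory containing the two subsystems *)

Section Generation.
Variable G : {set htriple gT}.
Let W := mho1 p 'Z(P).
Hypotheses (sGF : G \subset F) (closedG : sub_closed P G).
Hypothesis CFG : forall (Q R : {set gT}) (f : {ffun gT -> gT}),
  CF_mor P F W Q R f -> (Q, R, f) \in G.
Hypothesis NFG : forall (Q R : {set gT}) (f : {ffun gT -> gT}),
  NF_mor P F (thompson P) Q R f -> (Q, R, f) \in G.

Definition gen_mor (Q : {set gT}) f := (Q, P : {set gT}, restrf Q f) \in G.

Lemma gen_mor_mor Q f : gen_mor Q f -> mor Q f.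
Proof. exact: (subsetP sGF). Qed.

Lemma eq_gen_mor Q f g : {in Q, f =1 g} -> gen_mor Q f = gen_mor Q g.
Proof. by rewrite /gen_mor => /eq_restrf->. Qed.

Lemma gen_mor_triple Q R (f : {ffun gT -> gT}) :
  (Q : {set gT}, R : {set gT}, f) \in F -> gen_mor Q f ->
  (Q : {set gT}, R : {set gT}, f) \in G.
Proof.
move=> Ff; have [_ gR sfR] := triple_groups Ff; rewrite /gen_mor (triple_restrf Ff) => Gf.
case: closedG => _ _ /(_ _ _ _ Q R Gf); rewrite (triple_restrf Ff).
by apply=> //; rewrite subgrpE.
Qed.

Lemma gen_morS Q R f : gen_mor Q f -> R \subset Q -> gen_mor R f.
Proof.
move=> Gf sRQ; have mf := gen_mor_mor Gf.
case: closedG => _ _ /(_ _ _ _ R P Gf); rewrite !subgrpE sRQ subxx im_restrf //.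
move/(_ isT isT); rewrite (subset_trans _ (mor_im mf)) ?imsetS // => /(_ isT).
congr (_ \in G); congr (_, _, _); apply: eq_restrf => x Rx.
by rewrite restrf_in // (subsetP sRQ).
Qed.

Lemma gen_mor_comp Q R f g :
  gen_mor Q f -> gen_mor R g -> f @: Q \subset R -> gen_mor Q (g \o f).
Proof.
move=> Gf Gg sfR; have [mf mg] := (gen_mor_mor Gf, gen_mor_mor Gg).
have GQR : (Q : {set gT}, R : {set gT}, restrf Q f) \in G.
  apply: gen_mor_triple; first by apply: mor_triple => //; apply: mor_sub mg.
  by rewrite (eq_gen_mor (g := f)) // => x Qx; rewrite restrf_in.
case: closedG => _ /(_ _ _ _ _ _ GQR Gg) + _.
congr (_ \in G); congr (_, _, _); apply: eq_restrf => x Qx /=.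
by rewrite restrf_in restrf_in // (subsetP sfR) ?imset_f.
Qed.

Lemma mho1_center_sub : W \subset 'Z(P).
Proof. by rewrite gen_subG; apply/subsetP=> _ /imsetP[z Zz ->]; apply: groupX. Qed.

(** As [W] is central in [P], the system C_F(W) lives on all of [P]; as [W] lies in [Q], [f] is its
    own extension. *)
Lemma gen_mor_cent Q f : mor Q f -> W \subset Q -> {in W, f =1 id} -> gen_mor Q f.
Proof.
move=> mf sWQ fW; have sQP := mor_sub mf.
have cWP : 'C_P(W) = P.
  by apply/setIidPl; rewrite centsC (subset_trans mho1_center_sub) ?subsetIr.
apply: CFG; split; rewrite ?cWP ?subgrpE //.
exists (restrf Q f); split=> //; last by move=> x Wx; rewrite restrf_in ?fW ?(subsetP sWQ).
by rewrite !mulSGid ?(subset_trans sWQ).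
Qed.

Lemma gen_mor_thompson Q f :
  mor Q f -> thompson P \subset Q -> f @: thompson P = thompson P -> gen_mor Q f.
Proof.
move=> mf sJQ fJ; have sQP := mor_sub mf.
have nJP : 'N_P(thompson P) = P.
  by apply/setIidPl; apply: char_norm (thompson_char P).
apply: NFG; split; rewrite ?nJP ?subgrpE //.
exists (restrf Q f); split; rewrite ?im_restrf //.
by rewrite !mulSGid ?(subset_trans sJQ).
Qed.

(** * Automorphisms of subgroups of order m, larger domains being settled *)

Section LargerSubgroups.
Variable m : nat.
Hypothesis gen_large : forall Q f, m < #|Q| -> mor Q f -> gen_mor Q f.

Lemma ltn_card_join Q D : #|Q| = m -> ~~ (D \subset Q) -> m < #|Q <*> D|.
Proof. by move=> <- nDQ; rewrite proper_card // properE joing_subl join_subG subxx. Qed.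

Lemma gen_mor_cent_join Q X a :
    #|Q| = m -> Q \subset 'N_P(X) -> X \subset Q -> fully_normalized P F X ->
    a \in autF Q -> {in X, forall x, a x \in X} -> ~~ ('C_P(X) \subset Q) ->
  exists2 g, gen_mor Q g & {in X, g =1 a}.
Proof.
move=> oQ sQN sXQ fnX Fa aX nCQ; have [g mg eqg] := mor_ext_cent sQN sXQ fnX Fa aX.
exists g => //; apply: gen_morS (joing_subl Q 'C_P(X)).
by apply: (@gen_large (Q <*> 'C_P(X))%G) => //; apply: ltn_card_join.
Qed.

(* If g on Q C_P(X) agrees with a on X, then a g^-1 is the identity on X, hence
   lies in C_F(W). *)
Lemma gen_mor_fix_sub Q X a :
    #|Q| = m -> Q \subset 'N_P(X) -> X \subset Q -> fully_normalized P F X ->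
    W \subset X ->
    {in autF Q & X, forall b x, b x \in X} -> ~~ ('C_P(X) \subset Q) ->
  a \in autF Q -> gen_mor Q a.
Proof.
move=> oQ sQN sXQ fnX sWX stX nCQ Fa.
have sQP : Q \subset P by apply: subset_trans sQN (subsetIl _ _).
have aX : {in X, forall x, a x \in X} by move=> x; apply: stX.
have [g Gg eqg] := gen_mor_cent_join oQ sQN sXQ fnX Fa aX nCQ.
have mg := gen_mor_mor Gg; have ma := autF_mor sQP Fa.
have [R gQ _] := mor_im_group mg (subxx Q).
have [g' [mg' g'R gK g'K]] := mor_inv mg gQ.
rewrite (eq_gen_mor (g := (a \o g') \o g)) => [|x Qx]; last by rewrite /= gK.
apply: (@gen_mor_comp Q R _ _ Gg); last by rewrite gQ.
have mag : mor R (a \o g') by apply: (mor_comp mg' ma); rewrite g'R.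
have fixX x : x \in X -> x \in R /\ a (g' x) = x.
  move=> Xx; pose y := a^-1 x; have def_x : x = g y.
    by rewrite eqg ?stX ?groupV // permKV.
  have Xy : y \in X by rewrite stX ?groupV.
  have Qy := subsetP sXQ y Xy.
  by rewrite {1 2}def_x -gQ imset_f // gK // permKV.
apply: gen_mor_cent => //.
  by apply/subsetP=> x /(subsetP sWX)/fixX[].
by move=> x /(subsetP sWX)/fixX[].
Qed.

(** Write a as k followed by n, with k fixing [V] pointwise and n normalizing the centralizer of [V]
    in [autP Q]. As [W] lies in [V], k belongs to C_F(W). The condition on n lets it extend to Q
    C_{N_P(Q)}(V), which is larger than [Q]. *)
Lemma gen_mor_Frattini Q V a :
    #|Q| = m -> Q \subset P -> fully_normalized P F Q -> V \subset Q -> W \subset V ->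
    {in autF Q & V, forall b v, b v \in V} -> ~~ ('C_('N_P(Q))(V) \subset Q) ->
  a \in autF Q -> gen_mor Q a.
Proof.
move=> oQ sQP fnQ sVQ sWV stV nCQ Fa.
have [k [n [/setIP[Fk /astabP fixk] /setIP[Fn nBn] ->]]] :=
  Frattini_stable stV (sylow_autP sQP fnQ) Fa.
have imQn := autF_im sQP Fn; have mn := autF_mor sQP Fn.
rewrite (eq_gen_mor (g := n \o k)) => [|x _]; last by rewrite permM.
apply: (@gen_mor_comp Q Q); last by rewrite autF_im.
  apply: gen_mor_cent; first exact: autF_mor.
    exact: subset_trans sWV sVQ.
  by move=> x /(subsetP sWV)/fixk.
have sCN : 'C_('N_P(Q))(V) \subset 'N_P(Q) by apply: subsetIl.
have nCQ' : 'C_('N_P(Q))(V) \subset 'N(Q) by apply: subset_trans sCN (subsetIr _ _).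
have sQN : Q \subset 'N_P(Q) by rewrite subsetI sQP normG.
have fnQn : fully_normalized P F (n @: Q) by rewrite imQn.
have sDN : Q <*> 'C_('N_P(Q))(V) \subset 'N_P(Q) by rewrite join_subG sQN.
have [x Dx|g mg eqg] := @mor_ext Q (Q <*> 'C_('N_P(Q))(V))%G n mn fnQn (joing_subl _ _) sDN.
  rewrite imQn; move: Dx; rewrite /= norm_joinEr // => /mulsgP[q c Qq /setIP[NPc cVc] ->].
  have Fc := conj_autF sQP NPc; have nQc : c \in 'N(Q) by case/setIP: NPc.
  have: conj_aut Q c ^ n \in 'C_(autP Q)(V | 'P).
    rewrite memJ_norm // inE mem_morphim //=; apply/astabP=> v Vv.
    by rewrite /= apermE norm_conj_autE ?(subsetP sVQ) // conjgE -(centP cVc) ?mulKg.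
  have Fcn : conj_aut Q c ^ n \in autF Q by rewrite groupJ.
  case/setIP=> /(autPP (autF_Aut sQP Fcn))[y NPy eqy] _.
  exists (n q * y) => [|z Qz]; first by rewrite groupM // (subsetP sQN) ?autF_closed.
  have Qzq : z ^ q \in Q by rewrite groupJ.
  rewrite !conjgM; have /= <- := morphJ (Morphism (morM mn)) Qz Qq.
  by rewrite -eqy ?(autF_closed sQP) // -permM -conjgC permM norm_conj_autE.
rewrite -(eq_gen_mor eqg); apply: gen_morS (joing_subl Q 'C_('N_P(Q))(V)).
by apply: (@gen_large (Q <*> 'C_('N_P(Q))(V))%G) => //; apply: ltn_card_join.
Qed.

(** [Q] varies along with [X], because replacing [X] by a fully normalized conjugate moves [Q]
    too. *)
Definition reduction_pair Q X :=
  [/\ Q \proper P, #|Q| = m, fully_normalized P F Q, 'C_P(Q) \subset Q &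
      [/\ X \subset Q, 'Z('N_P(Q)) \subset X &
          {in autF Q & X, forall b x, b x \in X}]].

Lemma sub_normalizer_stable Q X :
    Q \subset P -> X \subset Q -> {in autF Q & X, forall b x, b x \in X} ->
  'N_P(Q) \subset 'N_P(X).
Proof.
move=> sQP sXQ stX; apply/subsetP=> x NPx; have /setIP[Px nQx] := NPx.
rewrite inE Px inE; apply/subsetP=> _ /imsetP[z Xz ->].
by rewrite -(@norm_conj_autE _ Q) ?(subsetP sXQ) // stX ?conj_autF.
Qed.

(** [g] is defined on N_P(Q), which is larger than [Q]; so [g] and its inverse lie in [G], and
    conjugation by [g] carries membership in [G] from [autF R] back to [autF Q]. Full normalization
    of [Q] makes N_P(R) the image of N_P(Q), which transfers the remaining conditions. *)
Lemma reduction_pair_transport Q X R Y g :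
    reduction_pair Q X -> mor 'N_P(X) g -> g @: Q = R -> g @: X = Y ->
  reduction_pair R Y /\
    ({in autF R, forall b, gen_mor R b} -> {in autF Q, forall a, gen_mor Q a}).
Proof.
case=> ltQP oQ fnQ cQ [sXQ sZX stX] mg gQ gX; have sQP := proper_sub ltQP.
set S := 'N_P(Q)%G; have sSN : S \subset 'N_P(X) by apply: sub_normalizer_stable stX.
have sQS : Q \subset S by rewrite subsetI sQP normG.
have mgS : mor S g := morS mg sSN; have mgQ : mor Q g := morS mgS sQS.
have [S1 gS oS1] := mor_im_group mgS (subxx S).
have ltmS : m < #|S|.
  by rewrite -oQ; apply/proper_card/(nilpotent_proper_norm (pgroup_nil pP)).
have [R' ] := mor_im_group mgQ (subxx Q); rewrite gQ => /val_inj<- oR.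
have sRP : R \subset P by rewrite -gQ mor_im.
have gS_sub : S1 \subset 'N_P(R).
  by rewrite -gS -gQ; apply: mor_norm mgS sQS (subsetIr _ _).
have NR : 'N_P(R) = S1.
  by apply/esym/eqP; rewrite eqEcard gS_sub oS1 -gQ fully_normalized_leq.
have comm_g s z : s \in S -> z \in S -> commute (g s) (g z) -> commute s z.
  by move=> Ss Sz cgsz; apply: (mor_inj mgS); rewrite ?groupM // !(morM mgS).
split; last first.
  move=> genR a Fa; have [h _ hE] := autF_transport mgQ gQ.
  have [Fb hg] := hE a Fa; have [g' [mg' g'S gK g'K]] := mor_inv mgS gS.
  have gen_g' : gen_mor R g'.
    apply: (@gen_morS S1); first by apply: gen_large; rewrite ?oS1.
    by rewrite -gS -gQ imsetS.
  have gen_g : gen_mor Q g by apply: gen_morS sQS; apply: gen_large.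
  have Sa x : x \in Q -> a x \in S by move=> Qx; rewrite (subsetP sQS) ?(autF_closed sQP).
  rewrite (eq_gen_mor (g := g' \o (h a \o g))) => [|x Qx]; last by rewrite /= hg // gK ?Sa.
  have imhg : (h a \o g) @: Q = R by rewrite imset_comp gQ autF_im.
  have gen_hg : gen_mor Q (h a \o g).
    by apply: (gen_mor_comp gen_g (genR _ Fb)); rewrite gQ.
  by apply: (gen_mor_comp gen_hg gen_g'); rewrite imhg.
split; rewrite ?oR //.
- by rewrite properEcard sRP oR proper_card.
- move=> T k [Fk <-]; rewrite NR oS1 -gQ -imset_comp; apply: fully_normalized_leq => //.
  by apply: (mor_comp mgQ (triple_mor Fk)); rewrite gQ.
- apply/subsetP=> y CRy; have /setIP[_ cRy] := CRy.
  have: y \in S1 by rewrite -NR (subsetP _ y CRy) // setIS ?cent_sub.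
  rewrite -gS => /imsetP[s Ss def_y]; rewrite -gQ def_y imset_f // (subsetP cQ) //.
  rewrite inE (subsetP (subsetIl _ _) s Ss); apply/centP=> z Qz.
  apply: comm_g => //; first exact: (subsetP sQS).
  by rewrite -def_y; apply: (centP cRy); rewrite -gQ imset_f.
split; first by rewrite -gX -gQ imsetS.
  rewrite /= NR; apply/subsetP=> y /setIP[]; rewrite -gS => /imsetP[s Ss ->] cSy.
  rewrite -gX imset_f // (subsetP sZX) // inE Ss; apply/centP=> z Sz.
  by apply: comm_g => //; apply: (centP cSy); rewrite imset_f.
have [g' [mg' g'R gK g'K]] := mor_inv mgQ gQ.
move=> b y Fb; rewrite -gX => /imsetP[x Xx ->]; have Qx := subsetP sXQ x Xx.
have mb := autF_mor sRP Fb.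
have mbg : mor Q (b \o g) by apply: (mor_comp mgQ mb); rewrite gQ.
have imbg : (b \o g) @: Q = R by rewrite imset_comp gQ autF_im.
have mc : mor Q (g' \o (b \o g)) by apply: (mor_comp mbg mg'); rewrite imbg.
have imc : (g' \o (b \o g)) @: Q = Q by rewrite imset_comp imbg g'R.
have [|a Fa eqa] := mor_autF mc; first by rewrite imc.
have -> : b (g x) = g (a x); last by rewrite imset_f ?stX.
by rewrite eqa //= g'K // (autF_closed sRP) // -gQ imset_f.
Qed.

(** J(N_P(X)) lies in X ≤ Q ≤ N_P(Q) ≤ N_P(X), so [Q] and both normalizers share one Thompson
    subgroup. It is stable because characteristic in [Q], and it contains Z(N_P(Q)). *)
Lemma reduction_pair_thompson Q X :
    reduction_pair Q X -> thompson 'N_P(X) \subset X ->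
  [/\ thompson 'N_P(X) = thompson Q & reduction_pair Q (thompson_group 'N_P(X))].
Proof.
case=> ltQP oQ fnQ cQ [sXQ sZX stX] sJX; have sQP := proper_sub ltQP.
have sSN := sub_normalizer_stable sQP sXQ stX.
have sQS : Q \subset 'N_P(Q) by rewrite subsetI sQP normG.
have sJQ := subset_trans sJX sXQ.
have eqJQ := thompson_intermediate sJQ (subset_trans sQS sSN).
have eqJS := thompson_intermediate (subset_trans sJQ sQS) sSN.
split=> //; split=> //; split=> //=.
  by rewrite -eqJS center_sub_thompson.
move=> b x Fb; rewrite -eqJQ; have Qb := autF_Aut sQP Fb.
have /charP[sJ /(_ (autm_morphism Qb) (injm_autm Qb) (im_autm Qb)) /= fixJ] := thompson_char Q.
move=> Jx; rewrite -fixJ -(autmE Qb) mem_morphim //.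
exact: (subsetP sJ).
Qed.

Lemma autF_restr Q X a :
    Q \subset P -> X \subset Q -> a \in autF Q -> {in X, forall x, a x \in X} ->
  exists2 b, b \in autF X & {in X, b =1 a}.
Proof.
move=> sQP sXQ Fa aX; apply: mor_autF; first exact: morS (autF_mor sQP Fa) sXQ.
by apply/subsetP=> _ /imsetP[x Xx ->]; apply: aX.
Qed.

Lemma autF_cent Q (A : {set gT}) b s :
    Q \subset P -> A \subset Q -> {in autF Q & A, forall a x, a x \in A} ->
    b \in autF Q -> s \in Q -> s \in 'C(A) ->
  b s \in 'C(A).
Proof.
move=> sQP sAQ stA Fb Qs /centP cAs; apply/centP=> z Az.
have Ay : b^-1 z \in A by rewrite stA ?groupV.
have mb := autF_mor sQP Fb; have Qy := subsetP sAQ _ Ay.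
by rewrite -(permKV b z) /commute -!(morM mb) // cAs.
Qed.

Lemma reduction_pair_gen Q X :
  reduction_pair Q X -> {in autF Q, forall a, gen_mor Q a}.
Proof.
(* As |X| ≤ |P|, base |P| + 1 encodes the lexicographic order on (|N_P(X)|, |X|); the induction is
   on the distance of [mu] from its upper bound. *)
pose mu X := (#|'N_P(X)| * #|P|.+1 + #|X|)%N.
have [n] := ubnP (#|P| * #|P|.+1 + #|P| - mu X).
elim: n Q X => // n IHn Q X ltn redQX.
have [ltQP oQ fnQ cQ [sXQ sZX stX]] := redQX; have sQP := proper_sub ltQP.
have sXP := subset_trans sXQ sQP.
have IH R Y : reduction_pair R Y ->
    #|'N_P(X)| < #|'N_P(Y)| \/ #|'N_P(X)| <= #|'N_P(Y)| /\ #|X| < #|Y| ->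
  {in autF R, forall a, gen_mor R a}.
- move=> redRY ltXY; apply: IHn (redRY); rewrite -ltnS; apply: leq_trans ltn; rewrite ltnS.
  have [ltRP _ _ _ [sYR _ _]] := redRY.
  have leYP : #|Y| <= #|P| := subset_leq_card (subset_trans sYR (proper_sub ltRP)).
  have leXP : #|X| <= #|P| := subset_leq_card sXP.
  have leNYP : #|'N_P(Y)| <= #|P| by rewrite subset_leq_card ?subsetIl.
  have ltmu : mu X < mu Y.
    case: ltXY => [ltN | [leN ltc]]; last by rewrite /mu -addnS leq_add ?leq_mul.
    rewrite /mu; apply: (@leq_trans (#|'N_P(X)|.+1 * #|P|.+1)).
      by rewrite mulSn addnC -addSn leq_add2r ltnS.
    by apply: leq_trans (leq_addr _ _); rewrite leq_mul.
  have lemu : mu Y <= #|P| * #|P|.+1 + #|P| by rewrite leq_add ?leq_mul.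
  by rewrite ltn_sub2l // (leq_trans ltmu).
have [f mf fnf] := exists_fully_normalized sXP.
have [Y fX _] := mor_im_group mf (subxx X); rewrite fX in fnf.
(* If a fully normalized conjugate has a strictly larger normalizer, a morphism on N_P(X) carries
   the whole pair there, and induction applies. Otherwise [X] is itself fully normalized. *)
have [leN | ltN] := leqP #|'N_P(Y)| #|'N_P(X)|; last first.
  have [g mg gX] := mor_extend_normalizer mf fX fnf.
  have sQN : Q \subset 'N_P(X).
    apply: subset_trans (sub_normalizer_stable sQP sXQ stX).
    by rewrite subsetI sQP normG.
  have [R gQ _] := mor_im_group mg sQN.
  have [redRY] := reduction_pair_transport redQX mg gQ gX.
  by apply; apply: (IH R Y) => //; left.
have fnX : fully_normalized P F X := fully_normalized_max mf fX fnf leN.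
set N := 'N_P(X)%G; have sSN := sub_normalizer_stable sQP sXQ stX.
have sQS : Q \subset 'N_P(Q) by rewrite subsetI sQP normG.
have sQN : Q \subset N := subset_trans sQS sSN.
have sNP : N \subset P := subsetIl _ _.
have sXN : X \subset N := subset_trans sXQ sQN.
have nXN : X <| N by rewrite /normal sXN subsetIr.
have sZPS : 'Z(P) \subset 'Z('N_P(Q)).
  rewrite subsetI (subset_trans _ sQS) ?(subset_trans _ cQ) ?setIS ?centS //=.
  by rewrite subIset // centS ?orbT ?subsetIl.
have sWX : W \subset X by rewrite (subset_trans mho1_center_sub) ?(subset_trans sZPS).
have [cXQ | ncXQ] := boolP ('C_P(X) \subset Q); last first.
  by move=> a; apply: gen_mor_fix_sub fnX _ _ _.
(* If C_P(X) lies in [Q] but not in [X], then X C_P(X) is a larger stable subgroup that N_P(X) still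
   normalizes. *)
have [cX | ncX] := boolP ('C_P(X) \subset X); last first.
  apply: (IH Q (X <*> 'C_P(X))%G).
    split=> //; split; first by rewrite join_subG sXQ.
      exact: subset_trans sZX (joing_subl _ _).
    move=> b x Fb; apply: (@Aut_gen_closed _ Q _ _ (X <*> 'C_P(X))%G).
    - exact: autF_Aut Fb.
    - by rewrite subUset sXQ.
    move=> s /setUP[Xs | Cs]; first by rewrite (subsetP (joing_subl _ _)) // stX.
    rewrite (subsetP (joing_subr _ _)) // inE; have Qs := subsetP cXQ s Cs.
    rewrite (subsetP sQP) ?(autF_closed sQP) //.
    by case/setIP: Cs => _ cXs; apply: autF_cent stX _ _ _.
  right; split; last by rewrite proper_card // properE joing_subl join_subG subxx.
  rewrite subset_leq_card // subsetI sNP normsY ?subsetIr //.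
  by rewrite normsI ?norms_cent ?subsetIr // (subset_trans sNP) ?normG.
have cNX : 'C_N(X) \subset X by rewrite (subset_trans _ cX) ?setSI.
pose U := center_closure_group (autF_group X) N.
have autX := autF_sub sXP.
have sUZ : U \subset 'Z(X) := center_closure_sub_center autX cNX sXN.
have sUX : U \subset X := subset_trans sUZ (center_sub X).
have stU := center_closure_stable autX sUX.
pose V := mho1_group p U; have sVU : V \subset U.
  by rewrite gen_subG; apply/subsetP=> _ /imsetP[u Uu ->]; apply: groupX.
have sVX := subset_trans sVU sUX.
have stVX := mho1_stable autX (p := p) sUX stU.
have stV : {in autF Q & V, forall b v, b v \in V}.
  move=> b v Fb Vv; have [|c Fc eqc] := autF_restr sQP sXQ Fb; first by move=> x; apply: stX.
  by rewrite -eqc ?(subsetP sVX) // stVX.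
have sWV : W \subset V.
  apply/genS/imsetS; apply: subset_trans (sub_center_closure _ _).
  rewrite subsetI (subset_trans sZPS) ?(subset_trans sZX) //=.
  by rewrite subIset // centS ?orbT.
have nVN : N \subset 'N(V).
  apply/subsetP=> x Nx; rewrite inE; apply/subsetP=> _ /imsetP[v Vv ->].
  rewrite -(@norm_conj_autE _ X) ?(subsetP sVX) ?(subsetP (subsetIr _ _) x Nx) //.
  by rewrite stVX // conj_autF.
have nTN : N \subset 'N('C_N(V)) by rewrite normsI ?normG ?norms_cent.
have sNNT : N \subset 'N_P('C_N(V)) by rewrite subsetI sNP.
have sylX := sylow_autP sXP fnX.
have [sCQ | nsCQ] := boolP ('C_('N_P(Q))(V) \subset Q); last first.
  by move=> a; apply: gen_mor_Frattini stV nsCQ => //; apply: subset_trans sVX sXQ.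
(* An element of Q C_N(V) normalizing [Q] lies in Q C_{N_P(Q)}(V) = Q. So [Q] is self-normalizing in
   this nilpotent group, hence all of it. *)
have sTQ : 'C_N(V) \subset Q.
  have sDN : Q <*> 'C_N(V) \subset N by rewrite join_subG sQN subsetIl.
  have nilD := pgroup_nil (pgroupS sDN (pgroupS sNP pP)).
  apply: subset_trans (joing_subr Q _) _.
  rewrite [_ <*> _](nilpotent_sub_norm nilD (joing_subl _ _)) //.
  apply/subsetP=> x /setIP[]; rewrite /= norm_joinEl ?(subset_trans sQN) //.
  move=> /mulsgP[q t Qq /setIP[Nt cVt] ->] nQx; rewrite groupM // (subsetP sCQ) //.
  rewrite !in_setI cVt (subsetP sNP) //= andbT.
  by move: nQx; rewrite groupMl // (subsetP (normG Q)).
have sXT : X \subset 'C_N(V).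
  by rewrite subsetI sXN centsC (subset_trans sVU) // (subset_trans sUZ) ?subsetIr.
have [sTX | nsTX] := boolP ('C_N(V) \subset X); last first.
  apply: (IH Q ('C_N(V))%G).
    split=> //; split=> //; first exact: subset_trans sZX sXT.
    move=> b t Fb Tt; have Qt := subsetP sTQ t Tt; have /setIP[_ cVt] := Tt.
    rewrite inE (subsetP sQN) ?(autF_closed sQP) //=.
    by apply: autF_cent stV _ _ _ => //; apply: subset_trans sVX sXQ.
  right; split; last by rewrite proper_card // properE sXT.
  exact: subset_leq_card.
have sJX : thompson N \subset X.
  exact: (thompson_sub_of_mho1_cent autX p_pr (pgroupS sNP pP) nXN cNX sylX sTX).
have [eqJ redQJ] := reduction_pair_thompson redQX sJX.
have [eqNP | ltNP] := eqVproper sNP.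
  have [_ _ _ _ [sJQ _ stJ]] := redQJ; rewrite /= eqNP in sJQ stJ.
  move=> a Fa; apply: gen_mor_thompson (autF_mor sQP Fa) sJQ _.
  apply/eqP; rewrite eqEcard card_imset ?leqnn ?andbT; last exact: perm_inj.
  by apply/subsetP=> _ /imsetP[x Jx ->]; apply: stJ.
apply: (IH Q _ redQJ); left; apply: proper_card.
apply: proper_sub_trans (nilpotent_proper_norm (pgroup_nil pP) ltNP) _.
by rewrite setIS // char_norms // thompson_char.
Qed.

(** If C_P(R) is not inside [R], each automorphism extends to the larger group R C_P(R). Otherwise
    [R] paired with itself is a reduction pair. *)
Lemma fully_normalized_gen R :
    R \proper P -> #|R| = m -> fully_normalized P F R ->
  {in autF R, forall a, gen_mor R a}.
Proof.
move=> ltRP oR fnR; have sRP := proper_sub ltRP.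
have sRN : R \subset 'N_P(R) by rewrite subsetI sRP normG.
have stR : {in autF R & R, forall b x, b x \in R} by move=> b x; apply: autF_closed.
have [cR | ncR] := boolP ('C_P(R) \subset R); last first.
  move=> a Fa; have aR : {in R, forall x, a x \in R} by move=> x; apply: stR.
  have [g Gg eqg] := gen_mor_cent_join oR sRN (subxx _) fnR Fa aR ncR.
  by rewrite -(eq_gen_mor eqg).
apply: (@reduction_pair_gen R R); split=> //; split=> //.
by apply: subset_trans cR; rewrite /center -setIA setIS // subIset // centS ?orbT.
Qed.

End LargerSubgroups.

(** Induction on |P| - |Q|. For proper [Q], choose maps g and g2 from the normalizers of [Q] and
    f(Q) taking these subgroups to one fully normalized conjugate [R]. Then [f] is g, followed by
    some c in [autF R], followed by the inverse of g2; the outer two are restrictions from larger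
    domains. *)
Lemma gen_mor_all Q f : mor Q f -> gen_mor Q f.
Proof.
have [n] := ubnP (#|P| - #|Q|); elim: n Q f => // n IHn Q f ltn mf.
have sQP := mor_sub mf.
have [eqQP | ltQP] := eqVproper sQP.
  have /charP[sJ /(_ _ (mor_injm mf)) fixJ] := thompson_char Q.
  have fQ : Morphism (morM mf) @* Q = Q.
    apply/eqP; rewrite eqEcard card_injm ?mor_injm // leqnn andbT.
    by rewrite -(mor_imE mf) // {2}eqQP mor_im.
  by apply: gen_mor_thompson; rewrite // -eqQP // (mor_imE mf) ?fixJ.
have gen_large R g : #|Q| < #|R| -> mor R g -> gen_mor R g.
  move=> ltQR mg; apply: IHn => //; rewrite -ltnS; apply: leq_trans ltn.
  by rewrite ltnS ltn_sub2l // (leq_trans ltQR) // subset_leq_card ?(mor_sub mg).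
have [f0 mf0 fnR] := exists_fully_normalized sQP.
have [R f0Q oR] := mor_im_group mf0 (subxx Q); rewrite f0Q in fnR.
have sRP : R \subset P by rewrite -f0Q mor_im.
have [Q2 fQ oQ2] := mor_im_group mf (subxx Q).
have sQ2P : Q2 \subset P by rewrite -fQ mor_im.
have [f' [mf' f'Q2 fK f'K]] := mor_inv mf fQ.
have mf0f' : mor Q2 (f0 \o f') by apply: (mor_comp mf' mf0); rewrite f'Q2.
have im_f0f' : (f0 \o f') @: Q2 = R by rewrite imset_comp f'Q2.
have [g mg gQ] := mor_extend_normalizer mf0 f0Q fnR.
have [g2 mg2 g2Q2] := mor_extend_normalizer mf0f' im_f0f' fnR.
have normlt D : D \proper P -> #|D| < #|'N_P(D)|.
  by move=> ltDP; apply/proper_card/(nilpotent_proper_norm (pgroup_nil pP)).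
have sDN D : D \subset P -> D \subset 'N_P(D) by move=> sDP; rewrite subsetI sDP normG.
have ltQ2P : Q2 \proper P by rewrite properEcard sQ2P oQ2 proper_card.
have ltRP : R \proper P by rewrite properEcard sRP oR proper_card.
have [S gN oS] := mor_im_group mg (subxx _).
have [S2 g2N oS2] := mor_im_group mg2 (subxx _).
have [g' [mg' g'S gK g'K]] := mor_inv mg gN.
have [g2' [mg2' g2'S2 g2K g2'K]] := mor_inv mg2 g2N.
have sRS : R \subset S by rewrite -gN -gQ imsetS ?sDN.
have sRS2 : R \subset S2 by rewrite -g2N -g2Q2 imsetS ?sDN.
have g'R : g' @: R = Q.
  rewrite -gQ -imset_comp (@eq_in_imset _ _ _ id) ?imset_id // => x Qx /=.
  by rewrite gK ?(subsetP (sDN _ sQP)).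
have mfg' : mor R (f \o g') by apply: (mor_comp (morS mg' sRS) mf); rewrite g'R.
have imfg' : (f \o g') @: R = Q2 by rewrite imset_comp g'R.
have mc : mor R (g2 \o (f \o g')).
  by apply: (mor_comp mfg' (morS mg2 (sDN _ sQ2P))); rewrite imfg'.
have imc : (g2 \o (f \o g')) @: R = R by rewrite imset_comp imfg'.
have [|c Fc eqc] := mor_autF mc; first by rewrite imc.
have gen_c := fully_normalized_gen gen_large ltRP oR fnR Fc.
have gen_g : gen_mor Q g.
  by apply: (gen_morS _ (sDN _ sQP)); apply: (@gen_large 'N_P(Q)%G); rewrite ?normlt.
have gen_g2' : gen_mor R g2'.
  by apply: gen_morS sRS2; apply: gen_large; rewrite // oS2 -oQ2 normlt.
have gen_cg : gen_mor Q (c \o g) by apply: (gen_mor_comp gen_g gen_c); rewrite gQ.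
have imcg : (c \o g) @: Q = R by rewrite imset_comp gQ autF_im.
rewrite (eq_gen_mor (g := g2' \o (c \o g))) => [|x Qx].
  by apply: (gen_mor_comp gen_cg gen_g2'); rewrite imcg.
have Rgx : g x \in R by rewrite -gQ imset_f.
have NQx := subsetP (sDN _ sQP) x Qx.
by rewrite /= eqc //= gK // g2K // (subsetP (sDN _ sQ2P)) // -fQ imset_f.
Qed.

End Generation.

End Category.

Lemma AutP_autP (gT : finGroupType) (P : {group gT}) : AutP P = autP P P.
Proof.
apply/setP=> a; apply/setIdP/idP => [[Pa /exists_inP[g Pg /forall_inP ag]] | Pa].
  apply/autPP => //; exists g^-1; first by rewrite inE groupV Pg (subsetP (normG P)) ?groupV.
  by move=> z Pz; apply/eqP/ag.
have AutPa : a \in Aut P.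
  case/morphimP: Pa => x Nx _ ->.
  by rewrite (subsetP (Aut_conj_aut P 'N(P))) // mem_morphim.
split=> //; have /(autPP _ AutPa)[x /setIP[Px _] ax] := Pa.
apply/exists_inP; exists x^-1; first by rewrite groupV.
by apply/forall_inP=> z Pz; rewrite invgK ax.
Qed.

Theorem theorem1p6 (gT : finGroupType) (p : nat) (P : {group gT})
    (F : {set htriple gT}) :
  prime p -> p.-group P -> P :!=: 1%g -> saturated p P F ->
  forall (Q R : {set gT}) (f : {ffun gT -> gT}),
    (Q, R, f) \in F <->
    fs_generated P F
      (fun Q1 R1 f1 => CF_mor P F (mho1 p 'Z(P)) Q1 R1 f1 \/
                       NF_mor P F (thompson P) Q1 R1 f1) Q R f.
Proof.
move=> p_pr pP _ [catF conjF sylF extF] Q R f; split=> [FQR G sGF genG closedG | genQR].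
  have sylP : p.-Sylow(autF P F P) (autP P P).
    have eqA : autF P F P = AutF P F.
      apply/setP=> a; rewrite (mem_autF catF conjF) // [in RHS]inE; congr (_ && _).
    by move: sylF; rewrite AutP_autP -eqA.
  have [/andP[_ gQ] /andP[_ gR] _] := triple_groups catF FQR.
  apply: (@gen_mor_triple _ _ _ catF G closedG (Group gQ) (Group gR)) => //.
  apply: (gen_mor_all catF conjF extF p_pr pP sylP sGF closedG).
  - by move=> Q1 R1 f1 CF; apply: genG; left.
  - by move=> Q1 R1 f1 NF; apply: genG; right.
  exact: triple_mor FQR.
(* For the converse take [G] to be [F] itself, which is closed under composition and restriction. *)
apply: genQR => // [Q1 R1 f1 [[] | []] // | ].
case: (catF) => _ idF compF _; split=> // Q1 R1 f1 Q' R' F1 /andP[sQ' gQ'] /andP[sR' gR'] sf.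
have [/andP[_ gQ1] _ _] := triple_groups catF F1.
apply: (@mor_triple _ _ _ catF conjF (Group gQ') (Group gR')) => //.
by apply: (@morS _ _ _ catF conjF (Group gQ1)); first exact: triple_mor F1.
Qed.
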